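(* For any integer $n\ge 2$, $P_{n,2}^{\mathrm{sqf}} = 1$ if $2\mid n$ and $P_{n,2}^{\mathrm{sqf}}=0$ if $2\nmid n$. For any odd prime $p$ and $n\ge 2$, \[ P_{n,p}^{\mathrm{sqf}} = 1 - \frac{3p-1}{p(p+1)^2} + O\left(\sum_{d=0}^n p^{d/2}\delta_{n,p}(d) + \frac{1}{p^{n/2}}\right), \] where the implied constant is absolute.
   Context: For a prime $p$, let $U_n(\mathbb{Z}_p)$ be the set of monic degree $n$ polynomials in $\mathbb{Z}_p[x]$ all of whose coefficients are not divisible by $p$, viewed via its non-leading coefficients as a subset of $\mathbb{Z}_p^n$ with normalized Haar measure $\lambda_p$. $P_{n,p}^{\mathrm{sqf}} = \lambda_p(\{f\in U_n(\mathbb{Z}_p): p^2\nmid\Delta(f)\})/\lambda_p(U_n(\mathbb{Z}_p))$, where $\Delta$ is the discriminant. Let $\mathbb{F}_p[x]_m$ be the set of monic polynomials in $\mathbb{F}_p[x]$. For $u\in\mathbb{F}_p[x]_m$ and $\alpha\in\mathbb{F}_p[x]/(u)$, let $\mathcal{A}_n(u;\alpha) = \{(a_1,\ldots,a_n)\in(\mathbb{F}_p\setminus\{0\})^n : a_1x^{n-1}+\cdots+a_n\equiv\alpha \bmod u\}$, and \[ \delta_{n,p}(d) = \max_{\substack{u\in\mathbb{F}_p[x]_m,\ \deg u = d,\ x\nmid u}}\ \max_{\alpha\in\mathbb{F}_p[x]/(u)}\left|\frac{|\mathcal{A}_n(u;\alpha)|}{(p-1)^n} - \frac{1}{p^d}\right|.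 \] *)

(* Defs.v *)
From HB Require Import structures.
From mathcomp Require Import all_boot all_order all_algebra.
From mathcomp Require Import all_classical all_reals all_analysis.

Set Implicit Arguments.
Unset Strict Implicit.
Unset Printing Implicit Defensive.

Import Order.TTheory GRing.Theory Num.Theory.
Import numFieldNormedType.Exports.

Local Open Scope classical_set_scope.
Local Open Scope ring_scope.

(* Z_p as the inverse limit of the rings Z/p^(k+1), k >= 0.  The exponent starts
   at 1 because 'Z_1 denotes Z/2; x k is the residue of x modulo p^(k+1). *)
Definition padic_compat (p : nat) (x : forall k, 'Z_(p ^ k.+1)) : Prop :=
  forall k, x k = (x k.+1 : nat)%:R.

Record padic_int (p : nat) := PadicInt {
  padic_res :> forall k, 'Z_(p ^ k.+1);
  padic_resP : padic_compat padic_res }.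

HB.instance Definition _ (p : nat) := gen_eqMixin (padic_int p).
HB.instance Definition _ (p : nat) := gen_choiceMixin (padic_int p).

Section PadicRing.
Variable p : nat.
Implicit Types x y z : padic_int p.

Lemma padic_ext x y : (forall k, x k = y k) -> x = y.
Proof.
case: x y => [x cx] [y cy] /= exy.
have E : x = y by apply: functional_extensionality_dep.
by subst y; congr PadicInt; exact: Prop_irrelevance.
Qed.

Lemma dvdn_Zp_trunc k : ((Zp_trunc (p ^ k.+1)).+2 %| (Zp_trunc (p ^ k.+2)).+2)%N.
Proof.
case: p => [|[|q]]; first by rewrite !exp0n.
  by rewrite !exp1n.
have gt1 i : (1 < q.+2 ^ i.+1)%N by rewrite -[X in (X < _)%N](exp1n i.+1) ltn_exp2r.
by rewrite !Zp_cast // dvdn_exp2l.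
Qed.

Lemma Zp_natr_mod k m :
  (m %% (Zp_trunc (p ^ k.+2)).+2)%N%:R = m%:R :> 'Z_(p ^ k.+1).
Proof. by apply: val_inj; rewrite !Zp_nat /= modn_dvdm ?dvdn_Zp_trunc. Qed.

Lemma padic_compat0 : @padic_compat p (fun=> 0).
Proof. by []. Qed.

Lemma padic_compat1 : @padic_compat p (fun=> 1).
Proof. by []. Qed.

Lemma padic_compatD x y : @padic_compat p (fun k => x k + y k).
Proof.
by move=> k; rewrite (padic_resP x) (padic_resP y) -natrD -Zp_natr_mod.
Qed.

Lemma padic_compatM x y : @padic_compat p (fun k => x k * y k).
Proof.
by move=> k; rewrite (padic_resP x) (padic_resP y) -natrM -Zp_natr_mod.
Qed.

Lemma padic_compatN x : @padic_compat p (fun k => - x k).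
Proof.
move=> k; rewrite (padic_resP x) /=; apply/eqP; rewrite eq_sym -addr_eq0.
rewrite -natrD -Zp_natr_mod modnDml subnK ?modnn //.
exact: ltnW (ltn_ord (x k.+1)).
Qed.

Let addA : associative (fun x y => PadicInt (padic_compatD x y)).
Proof. by move=> x y z; apply: padic_ext => k /=; rewrite addrA. Qed.
Let addC : commutative (fun x y => PadicInt (padic_compatD x y)).
Proof. by move=> x y; apply: padic_ext => k /=; rewrite addrC. Qed.
Let add0 : left_id (PadicInt padic_compat0)
  (fun x y => PadicInt (padic_compatD x y)).
Proof. by move=> x; apply: padic_ext => k /=; rewrite add0r. Qed.
Let addN : left_inverse (PadicInt padic_compat0)
  (fun x => PadicInt (padic_compatN x))
  (fun x y => PadicInt (padic_compatD x y)).
Proof. by move=> x; apply: padic_ext => k /=; rewrite addNr. Qed.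

HB.instance Definition _ :=
  GRing.isZmodule.Build (padic_int p) addA addC add0 addN.

Let mulA : associative (fun x y => PadicInt (padic_compatM x y)).
Proof. by move=> x y z; apply: padic_ext => k /=; rewrite mulrA. Qed.
Let mulC : commutative (fun x y => PadicInt (padic_compatM x y)).
Proof. by move=> x y; apply: padic_ext => k /=; rewrite mulrC. Qed.
Let mul1 : left_id (PadicInt padic_compat1)
  (fun x y => PadicInt (padic_compatM x y)).
Proof. by move=> x; apply: padic_ext => k /=; rewrite mul1r. Qed.
Let mulD : left_distributive (fun x y => PadicInt (padic_compatM x y)) +%R.
Proof. by move=> x y z; apply: padic_ext => k /=; rewrite mulrDl. Qed.
Let one_neq0 : PadicInt padic_compat1 != 0 :> padic_int p.
Proof.
by apply/eqP => /(congr1 (fun x : padic_int p => x 0%N)) /= /eqP; rewrite oner_eq0.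
Qed.

HB.instance Definition _ := GRing.Zmodule_isComNzRing.Build (padic_int p)
  mulA mulC mul1 mulD one_neq0.

HB.instance Definition _ := isPointed.Build (padic_int p) 0.

(* The p-adic topology: the residue classes modulo powers of p form a base. *)
Definition padic_open : set_system (padic_int p) :=
  [set V | forall x, V x -> exists k, forall y, y k = x k -> V y].

Lemma padic_res_le x y j k : (j <= k)%N -> y k = x k -> y j = x j.
Proof.
move=> /subnK <-; elim: (k - j)%N => [//|i IH] /= E.
by apply: IH; rewrite (padic_resP x) (padic_resP y) -addSn E.
Qed.

Let padic_openT : padic_open setT.
Proof. by move=> x _; exists 0%N. Qed.

Let padic_openI : setI_closed padic_open.
Proof.
move=> V W oV oW x [/oV[j jV] /oW[k kW]]; exists (maxn j k) => y E; split.
  by apply: jV; apply: padic_res_le E; exact: leq_maxl.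
by apply: kW; apply: padic_res_le E; exact: leq_maxr.
Qed.

Let padic_open_bigU (I : Type) (V : I -> set (padic_int p)) :
  (forall i, padic_open (V i)) -> padic_open (\bigcup_i V i).
Proof.
move=> oV x [i _ /oV[k kV]]; exists k => y /kV Vy; by exists i.
Qed.

HB.instance Definition _ := isOpenTopological.Build (padic_int p)
  padic_openT padic_openI padic_open_bigU.

End PadicRing.

(* p ^ m divides x in Z_p *)
Definition padic_dvd (p m : nat) (x : padic_int p) : Prop :=
  exists y : padic_int p, x = p%:R ^+ m * y.

(* Z_p ^ n with the Borel sigma-algebra of the product topology *)
Definition padic_space (p n : nat) :=
  g_sigma_algebraType (@open 'rV[padic_int p]_n).

(* A translation-invariant Borel probability measure on the compact group
   Z_p ^ n, i.e. its (unique) normalized Haar measure. *)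
Definition is_haar (R : realType) (p n : nat)
    (lambda : probability (padic_space p n) R) : Prop :=
  forall (t : 'rV[padic_int p]_n) (A : set (padic_space p n)),
    measurable A ->
    lambda [set t + x | x in (A : set 'rV[padic_int p]_n)] = lambda A.

(* The discriminant of a monic polynomial; the general formula also has a
   division by the leading coefficient. *)
Definition discriminant (A : comNzRingType) (f : {poly A}) : A :=
  (-1) ^+ 'C((size f).-1, 2) * resultant f f^`().

Definition U_set (n p : nat) : set {poly padic_int p} :=
  [set f | [/\ f \is monic, size f = n.+1 &
    forall i, (i <= n)%N -> ~ padic_dvd 1 f`_i]].

(* Identifies Z_p ^ n with the monic polynomials of degree n. *)
Definition monic_of_coefs (p n : nat) (a : 'rV[padic_int p]_n) :
  {poly padic_int p} := 'X^n + rVpoly a.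

Definition vol (R : realType) (p n : nat)
    (lambda : probability (padic_space p n) R)
    (S : set {poly padic_int p}) : R :=
  fine (lambda (@monic_of_coefs p n @^-1` S)).

Definition P_sqf (R : realType) (n p : nat)
    (lambda : probability (padic_space p n) R) : R :=
  vol lambda (@U_set n p `&` [set f | ~ padic_dvd 2 (discriminant f)]) /
  vol lambda (@U_set n p).

(* A class alpha in F_p[x]/(u) is given by any polynomial representing it; the
   entry a 0 i is the mathematical a_(i+1). *)
Definition A_set (n p : nat) (u alpha : {poly 'F_p}) : {set 'rV['F_p]_n} :=
  [set a : 'rV['F_p]_n | [forall i, a 0 i != 0] &&
    (u %| (\sum_(i < n) a 0 i *: 'X^(n.-1 - i)) - alpha)].

(* The classes modulo u of degree d are enumerated by the polynomials of degree
   < d (of size <= d).  Starting the maxima at 0 is harmless: the values are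
   nonnegative and both index sets are nonempty. *)
Definition delta (R : realType) (n p d : nat) : R :=
  \big[Num.max/0]_(u : {poly_d.+1 'F_p} |
      [&& (u : {poly 'F_p}) \is monic, size u == d.+1 & ~~ ('X %| u)])
    \big[Num.max/0]_(alpha : {poly_d 'F_p})
      `| #|A_set n u alpha|%:R / (p%:R - 1) ^+ n - (p%:R ^+ d)^-1 |.

(* Main.v *)
Require Import Defs.
From HB Require Import structures.
From mathcomp Require Import all_boot all_order all_algebra.
From mathcomp Require Import all_classical all_reals all_analysis.
From mathcomp Require Import ring lra zify.

Import Order.TTheory GRing.Theory Num.Theory.

Set Implicit Arguments.
Unset Strict Implicit.
Unset Printing Implicit Defensive.

Local Open Scope ring_scope.

(* The discriminant is, up to a unit, the determinant of multiplication
   by [f'] on [Z_p[x]/(f)].  If [f mod p] is squarefree it is a unit; if [f] and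
   [f'] share a divisor of degree at least 2 modulo [p], two rows of the matrix
   can be made divisible by [p]; in the remaining case, [f mod p = (x - a)^2 g]
   with [g] squarefree and [g(a) <> 0], and [p] odd, modulo [p^2] it is a unit
   times [f(b)] for a lift [b] of [a], so it is divisible by [p^2] for exactly one
   value in [p] of the second digit of [f(b)].  Hence the density is
   [S1 + (1 - 1/p) S2] with [S1], [S2] the proportions of both shapes among the
   polynomials over [F_p] with nonzero coefficients.  These are computed by
   inclusion-exclusion over the sets of monic irreducibles whose squares divide
   the polynomial, each divisibility condition of degree [d] costing an error
   [delta d].  For [p = 2] the reduction is [(x^(n+1) - 1)/(x - 1)], which is
   squarefree for [n] even and [(x - 1) h^2] with [h] nonconstant for [n] odd. *)

(** * Multiplication matrices and the resultant *)

Section ModMul.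
Import Pdiv.CommonRing Pdiv.RingMonic.
Variable A : comNzRingType.
Implicit Types f g h v : {poly A}.

(** The multiplication matrix has size [n] whatever [g] is, is multiplicative in [g] and commutes
    with reduction, so a factorisation of [f'] modulo p^2 factors its determinant; the Sylvester
    matrix has none of this. Since only p^2 matters, one Newton step suffices, and the Haar measure
    enters only through the equal masses of the classes modulo p^2. In the sieve, X is left out
    because the constant term is nonzero, which matches the restriction on the moduli in [delta];
    for S2 the factor X - b is left out too. The Moebius sums without one or two linear polynomials
    have generating series (1 - qT)/(1 - T) and (1 - qT)/(1 - T)^2, and T = q^(-2) gives the main
    term. At most q^d squarefree products have degree d, and their squares have degree 2d: this is
    the weight p^(d/2) of [delta d]. Stopping at degree n costs a multiple of p^(-n/2). *)

Definition modmul_mx n f g : 'M[A]_n := \matrix_i poly_rV (rmodp ('X^i * g) f).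

Lemma mul_rV_modmul_mx n f g v : f \is monic -> (size v <= n)%N ->
  poly_rV v *m modmul_mx n f g = poly_rV (rmodp (v * g) f).
Proof.
move=> mf sv; rewrite mulmx_sum_row.
have -> : v * g = \sum_(i < n) v`_i *: ('X^i * g).
  rewrite -[v in LHS](poly_rV_K sv) /rVpoly poly_def mulr_suml.
  apply: eq_bigr => i _; rewrite -scalerAl; congr (_ *: _).
  by rewrite valK mxE.
rewrite rmodp_sum // linear_sum; apply: eq_bigr => i _.
by rewrite rowK rmodpZ // linearZ /= mxE.
Qed.

Lemma modmul_mxM n f g h : f \is monic -> size f = n.+1 ->
  modmul_mx n f (g * h) = modmul_mx n f g *m modmul_mx n f h.
Proof.
move=> mf sf; apply/row_matrixP => i.
rewrite row_mul !rowK mul_rV_modmul_mx // ?rmodp_mulml ?mulrA //.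
by rewrite -ltnS -sf ltn_rmodpN0 // monic_neq0.
Qed.

Lemma modmul_mxC n f c : size f = n.+1 -> modmul_mx n f c%:P = c%:M.
Proof.
move=> sf; apply/matrixP => i j; rewrite !mxE rmodp_small; last first.
  rewrite sf (leq_ltn_trans (size_polyMleq _ _)) // size_polyXn.
  rewrite addSn /= ltnS (leq_trans _ (ltn_ord i)) // -addn1 leq_add2l.
  exact: size_polyC_leq1.
by rewrite coefMC coefXn eq_sym -val_eqE /=; case: eqP; rewrite ?mul1r ?mul0r.
Qed.

Lemma modmul_mxD n f g h : f \is monic ->
  modmul_mx n f (g + h) = modmul_mx n f g + modmul_mx n f h.
Proof.
by move=> mf; apply/row_matrixP => i; rewrite linearD /= !rowK mulrDr rmodpD // linearD.
Qed.

Lemma modmul_mx0 n f g : f \is monic -> rmodp g f = 0 -> modmul_mx n f g = 0.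
Proof.
move=> mf g0; apply/row_matrixP => i.
by rewrite rowK row0 -rmodp_mulmr // g0 mulr0 rmod0p linear0.
Qed.

(* In the basis [X^i f], [X^j] the Sylvester matrix is block triangular, and
   Euclidean division by [f] inverts the change from this basis to the
   monomials.  Its determinant is a sign, but a unit is enough here. *)
Lemma resultant_modmul n f g : f \is monic -> size f = n.+1 ->
  exists u u' : A, u * u' = 1 /\ resultant f g = u * \det (modmul_mx n f g).
Proof.
move=> mf sf; have en : n = (size f).-1 by rewrite sf.
subst n; rewrite /resultant; set m := (size g).-1; set n := (size f).-1.
pose W : 'M[A]_(m + n) :=
  col_mx (\matrix_i poly_rV ('X^i * f)) (\matrix_i poly_rV 'X^i).
have WE v : (size v <= m + n)%N ->
    row_mx (poly_rV (rdivp v f)) (poly_rV (rmodp v f)) *m W = poly_rV v.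
  move=> sv; rewrite mul_row_col.
  have sr : (size (rmodp v f) <= n)%N.
    by have := ltn_rmodpN0 v (monic_neq0 mf); rewrite [X in (_ < X)%N -> _]sf.
  have sd : (size (rdivp v f) <= m)%N.
    have [->|v0] := eqVneq (rdivp v f) 0; first by rewrite size_poly0.
    have: (size (rdivp v f * f)%R <= m + n)%N.
      have -> : rdivp v f * f = v - rmodp v f by rewrite {2}(rdivp_eq mf v) addrK.
      rewrite (leq_trans (size_polyD _ _)) // geq_max sv size_polyN.
      by rewrite (leq_trans sr) ?leq_addl.
    by rewrite size_Mmonic // sf addnS /= leq_add2r.
  rewrite [v in RHS](rdivp_eq mf) linearD; congr (_ + _).
    rewrite mulmx_sum_row -[rdivp v f in RHS](poly_rV_K sd) /rVpoly poly_def.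
    rewrite mulr_suml linear_sum; apply: eq_bigr => i _.
    by rewrite rowK -scalerAl linearZ valK /= mxE.
  rewrite mulmx_sum_row -[rmodp v f in RHS](poly_rV_K sr) /rVpoly poly_def.
  rewrite linear_sum; apply: eq_bigr => i _.
  by rewrite rowK linearZ valK /= mxE.
(* A left inverse is enough: its determinant is the inverse of the unit [\det W]. *)
have [W' W'W] : exists W' : ('M[A]_(m + n)), W' *m W = 1%:M.
  exists (\matrix_i row_mx (poly_rV (rdivp 'X^i f)) (poly_rV (rmodp 'X^i f))).
  apply/row_matrixP => i; rewrite row_mul rowK WE ?size_polyXn //.
  by apply/rowP => j; rewrite !mxE coefXn eq_sym.
have -> : Sylvester_mx f g = block_mx 1%:M 0
    (\matrix_j poly_rV (rdivp ('X^j * g) f)) (modmul_mx n f g) *m W.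
  apply/row_matrixP => i; rewrite row_mul /Sylvester_mx /block_mx.
  case: (split_ordP i) => j ->.
    rewrite !rowKu row_row_mx row1 row0 mul_row_col mul0mx addr0 -rowE rowK.
    by rewrite rowE mul_rV_lin1 /= rVpoly_delta.
  rewrite !rowKd row_row_mx !rowK WE.
    by rewrite rowE mul_rV_lin1 /= rVpoly_delta.
  have [->|g0] := eqVneq g 0; first by rewrite mulr0 size_poly0.
  apply: leq_trans (size_polyMleq _ _) _; rewrite size_polyXn addSn /=.
  by rewrite addnC -[size g]prednK ?size_poly_gt0 // addSnnS leq_add.
exists (\det W), (\det W'); rewrite mulrC -det_mulmx W'W det1; split=> //.
by rewrite det_mulmx det_lblock det1 mul1r mulrC.
Qed.

(** Multiplication by X is the companion matrix, whose characteristic polynomial is [f]; the sign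
    comes from passing from c - X to X - c. *)
Lemma det_modmul_XsubC n f c : f \is monic -> size f = n.+1 ->
  \det (modmul_mx n f ('X - c%:P)) = (-1) ^+ n * f.[c].
Proof.
move=> mf sf; have en : n = (size f).-1 by rewrite sf.
subst n; set n := (size f).-1.
rewrite -polyCN modmul_mxD // modmul_mxC //.
have -> : modmul_mx n f 'X = companionmx f.
  apply/matrixP => i j; rewrite !mxE -exprSr.
  have [|lt] := eqVneq (i : nat) n.-1.
    move=> ei; have n0 : (0 < n)%N := leq_ltn_trans (leq0n _) (ltn_ord i).
    rewrite ei prednK //.
    have -> : 'X^n = 1 * f + ('X^n - f) by rewrite mul1r addrC subrK.
    rewrite rmodp_addl_mul_small // ?coefB ?coefXn ?(ltn_eqF (ltn_ord j)) ?sub0r //.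
    rewrite sf ltnS; apply/leq_sizeP => k; rewrite leq_eqVlt => /predU1P[<-|nk].
      have := mf; rewrite monicE lead_coefE -/n => /eqP e.
      by rewrite coefB coefXn eqxx e subrr.
    by rewrite coefB coefXn gtn_eqF // nth_default ?subrr // sf.
  rewrite rmodp_small ?size_polyXn ?coefXn 1?eq_sym // sf !ltnS.
  by rewrite ltn_neqAle ltn_ord andbT; apply: contra lt => /eqP/(congr1 predn) /= ->.
rewrite -[X in X.[c]](companionmxK mf) /char_poly.
rewrite -[RHS]/(_ * horner_eval c _) -det_map_mx -detZ; congr (\det _).
apply/matrixP => i j; rewrite !mxE /= /horner_eval hornerD hornerN hornerC.
rewrite hornerMn hornerX.
by rewrite mulN1r opprB mulNrn.
Qed.

(** The determinant of M + X N is a polynomial in X with constant term [\det M]. With z = p^2, it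
    allows a matrix to be changed modulo p^2. *)
Lemma det_add_scale n (M N : 'M[A]_n) z :
  exists y, \det (M + z *: N) = \det M + z * y.
Proof.
pose P := \det (map_mx polyC M + 'X *: map_mx polyC N).
have PE c : P.[c] = \det (M + c *: N).
  rewrite -[LHS]/(horner_eval c _) -det_map_mx; congr (\det _).
  by apply/matrixP => i j; rewrite !mxE /= /horner_eval !hornerE.
have <- : P.[0] = \det M by rewrite PE scale0r addr0.
rewrite -PE.
elim/poly_ind: P {PE} => [|P c _]; first by exists 0; rewrite !horner0 mulr0 addr0.
by exists P.[z]; rewrite !hornerMXaddC mulr0 add0r addrC mulrC.
Qed.

End ModMul.

Section MapModMul.
Import Pdiv.CommonRing Pdiv.RingMonic.
Variables (A B : comNzRingType) (r : {rmorphism A -> B}).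

Lemma size_map_monic (f : {poly A}) : f \is monic -> size (map_poly r f) = size f.
Proof. by move=> mf; rewrite size_map_poly_id0 // (eqP mf) rmorph1 oner_eq0. Qed.

Lemma map_rmodp_monic (f g : {poly A}) : f \is monic ->
  map_poly r (rmodp g f) = rmodp (map_poly r g) (map_poly r f).
Proof.
move=> mf; rewrite [g in RHS](rdivp_eq mf) rmorphD rmorphM /=.
rewrite rmodp_addl_mul_small ?monic_map // [X in (_ < X)%N]size_map_monic //.
apply: (@leq_ltn_trans (size (rmodp g f))); first exact: size_poly.
by rewrite ltn_rmodpN0 // monic_neq0.
Qed.

Lemma map_modmul_mx n (f g : {poly A}) : f \is monic ->
  map_mx r (modmul_mx n f g) = modmul_mx n (map_poly r f) (map_poly r g).
Proof.
move=> mf; apply/matrixP => i j; rewrite !mxE.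
by rewrite -(map_polyXn r) -rmorphM -map_rmodp_monic // coef_map.
Qed.

End MapModMul.

(** * Square factors over finite fields *)

Section FpPoly.
Variable F : finFieldType.
Implicit Types f g q : {poly F}.

Lemma exists_monic_irreducible_dvd f : (1 < size f)%N ->
  exists q, [/\ q \is monic, irreducible_poly q & q %| f].
Proof.
elim: {f}(size f) {-2}f (leqnn (size f)) => [|n IH] f sf f1.
  by move: f1; rewrite ltnNge (leq_trans sf).
have f0 : f != 0 by rewrite -size_poly_gt0 ltnW.
have [/irreducibleP irr|] := boolP (irreducibleb f).
  exists ((lead_coef f)^-1 *: f); split.
  - by rewrite monicE lead_coefZ mulVf // lead_coef_eq0.
  - have e : (lead_coef f)^-1 *: f %= f by apply: eqp_scale; rewrite invr_eq0 lead_coef_eq0.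
    split; first by rewrite (eqp_size e).
    by move=> q sq qf; rewrite (eqp_trans (irr.2 q sq _)) // -?(eqp_dvdr _ e) // eqp_sym.
  - by rewrite dvdpZl // invr_eq0 lead_coef_eq0.
move=> nirr; have [d [sd df nd]] : exists d : {poly F}, [/\ size d != 1, d %| f & ~~ (d %= f)].
  apply: contrapT => H; move/negP: nirr; apply; apply/irreducibleP.
  by split=> // q sq qf; apply: contraT => nq; case: H; exists q.
have d0 : d != 0 by apply: contraNneq f0 => d0; move: df; rewrite d0 dvd0p.
have sdf : (size d < size f)%N.
  by rewrite ltn_neqAle dvdp_leq // andbT dvdp_size_eqp.
have [||q [mq iq qd]] := IH d; first by rewrite -ltnS (leq_trans sdf).
  by rewrite ltn_neqAle eq_sym sd size_poly_gt0.
by exists q; split=> //; exact: dvdp_trans df.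
Qed.

Lemma irreducible_dvdM q f g : irreducible_poly q ->
  (q %| f * g) = (q %| f) || (q %| g).
Proof.
move=> iq; have [qf|nqf] /= := boolP (q %| f); first by rewrite dvdp_mulr.
by rewrite Gauss_dvdpr // irreducible_poly_coprime.
Qed.

Lemma monic_irreducible_eq q q' : q \is monic -> q' \is monic ->
  irreducible_poly q -> irreducible_poly q' -> q %| q' -> q = q'.
Proof.
move=> mq mq' iq iq' d; apply/eqP; rewrite -eqp_monic //.
by apply: (iq'.2) => //; case: iq => s _; rewrite neq_ltn s orbT.
Qed.

Lemma coprimep_monic_irreducible f g :
  (f != 0) || (g != 0) ->
  reflect (exists q, [/\ q \is monic, irreducible_poly q, q %| f & q %| g])
    (~~ coprimep f g).
Proof.
move=> coefs_neq0; apply: (iffP idP) => [ncop|[q [mq iq qf qg]]].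
  have [|q [mq iq qg]] := @exists_monic_irreducible_dvd (gcdp f g).
    move: ncop; rewrite /coprimep; have: size (gcdp f g) != 0%N.
      by rewrite size_poly_eq0 gcdp_eq0 negb_and.
    by case: size => [|[]].
  by exists q; split=> //; apply: dvdp_trans qg _; rewrite ?dvdp_gcdl ?dvdp_gcdr.
apply/negP => cop; have : coprimep q q.
  exact: coprimep_dvdr qf (coprimep_dvdl qg cop).
by rewrite coprimepp => /eqP sq; case: iq; rewrite sq.
Qed.

End FpPoly.

(** * Repeated factors and the derivative over F_p *)

Section Perfect.
Variables (p : nat) (pr : prime p).
Implicit Types f q : {poly 'F_p}.

Lemma expfp (x : 'F_p) : x ^+ p = x.
Proof.
have pc := pchar_Fp pr; rewrite -pFrobenius_autE -[x]natr_Zp.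
by rewrite (pFrobenius_aut_nat pc).
Qed.

(** Only exponents divisible by p survive, and each coefficient is its own p-th power, so Frobenius
    collects the sum into a single p-th power. *)
Lemma deriv_eq0_pth_power q : q^`() = 0 -> exists h, q = h ^+ p.
Proof.
move=> dq; exists (\poly_(i < size q) q`_(i * p)).
have pcP : p \in [pchar {poly 'F_p}] by rewrite pchar_poly pchar_Fp.
have p0 := prime_gt0 pr.
rewrite poly_def -pFrobenius_autE rmorph_sum /=.
under eq_bigr do rewrite pFrobenius_autE exprZn expfp -exprM.
apply/polyP => j; rewrite coef_sum.
have [/dvdnP[i ->]|ndv] := boolP (p %| j)%N.
  have [lt|ge] := ltnP i (size q); last first.
    rewrite nth_default ?(leq_trans ge) ?leq_pmulr // big1 // => k _.
    rewrite coefZ coefXn eqn_pmul2r // gtn_eqF ?mulr0 //.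
    exact: leq_trans (ltn_ord k) ge.
  rewrite (bigD1 (Ordinal lt)) //= coefZ coefXn eqxx mulr1 big1 ?addr0 // => k nk.
  by rewrite coefZ coefXn eqn_pmul2r // eq_sym; move: nk; rewrite -val_eqE /= => /negPf->;
    rewrite mulr0.
rewrite big1 => [|k _]; last first.
  rewrite coefZ coefXn; case: eqP ndv => [->|_]; rewrite ?mulr0 //.
  by rewrite dvdn_mull.
case: j ndv => [|j ndv]; first by rewrite dvdn0.
have := congr1 (fun g : {poly 'F_p} => g`_j) dq; rewrite coef_deriv coef0.
move/eqP; rewrite -mulr_natr mulf_eq0 => /orP[/eqP //|].
by rewrite -(dvdn_pcharf (pchar_Fp pr)) (negPf ndv).
Qed.

(** Write f = s q with q a common irreducible factor of f and f'. Then q divides s q', so either q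
    divides s, or q' = 0 and q is a p-th power, which irreducibility forbids. *)
Lemma not_coprime_deriv_sq f : f != 0 -> ~~ coprimep f f^`() ->
  exists q, [/\ q \is monic, irreducible_poly q & q ^+ 2 %| f].
Proof.
move=> f0 /coprimep_monic_irreducible[|q [mq iq /dvdpP[s fE]]]; first by rewrite f0.
rewrite {1}fE derivM => /dvdpP[t E]; exists q; split=> //.
have : q %| s * q^`().
  by rewrite -(dvdp_addr _ (dvdp_mull s^`() (dvdpp q))) E dvdp_mull.
rewrite irreducible_dvdM // => /orP[qs|qq'].
  by rewrite fE expr2 dvdp_mul.
have q'0 : q^`() = 0.
  apply/eqP; apply: contraTT qq' => coefs_neq0; apply/negP => /(dvdp_leq coefs_neq0).
  by rewrite leqNgt lt_size_deriv // monic_neq0.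
have [h qE] := deriv_eq0_pth_power q'0.
have sh : size h != 1%N.
  apply: contraTneq iq.1 => /eqP/size_poly1P[c c0 hE].
  by rewrite qE hE -polyC_exp -leqNgt size_polyC_leq1.
have hq : h %= q by apply: (iq.2) => //; rewrite qE dvdp_exp // prime_gt0.
have h0 : h != 0 by apply: contraTneq (monic_neq0 mq) => h0; rewrite qE h0 expr0n gtn_eqF
  ?prime_gt0 ?eqxx.
have := eqp_size hq; rewrite [in RHS]qE; have := size_exp h p.
have := prime_gt1 pr; have := size_poly_gt0 h; rewrite h0.
case: (size h) sh => [|[|m]] // _ _ p1; case: size => [|k] //= -> [] /eqP.
by rewrite -{1}[m.+1]muln1 eqn_mul2l /= ltn_eqF.
Qed.

End Perfect.

(** * The possible shapes of a reduction *)

Section SquareFactors.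
Variable F : finFieldType.
Implicit Types f g q w : {poly F}.

Definition sqfree f := forall q, q \is monic -> irreducible_poly q -> ~~ (q ^+ 2 %| f).

Definition simple_double a f := [/\ ('X - a%:P) ^+ 2 %| f, ~~ (('X - a%:P) ^+ 3 %| f)
  & forall q, q \is monic -> irreducible_poly q -> q != 'X - a%:P -> ~~ (q ^+ 2 %| f)].

Lemma dvdp_deriv_exp q k f : q ^+ k.+1 %| f -> q ^+ k %| f^`().
Proof.
move=> /dvdpP[s ->]; rewrite derivM deriv_exp /= dvdp_add //.
  by rewrite exprS mulrCA dvdp_mull // dvdp_mull.
by rewrite dvdp_mull // -mulrnAl dvdp_mull.
Qed.

(** An irreducible factor occurring twice divides both [f] and [f']. In the last case [w] is such a
    factor of degree at least 2, or the square of a linear factor whose cube divides [f], or the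
    product of two distinct repeated factors. *)
Lemma sqfree_simple_or_double f : f != 0 ->
  [\/ sqfree f, exists a, simple_double a f |
    exists w, [/\ w \is monic, (2 < size w)%N, w %| f & w %| f^`()]].
Proof.
move=> f0; have [sf|nsf] := pselect (sqfree f); first by constructor 1.
have [q [mq iq q2]] : exists q, [/\ q \is monic, irreducible_poly q & q ^+ 2 %| f].
  apply: contrapT => H; apply: nsf => q mq iq; apply/negP => q2.
  by apply: H; exists q.
have qf : q %| f by apply: dvdp_trans q2; rewrite expr2 dvdp_mulr.
have qf' : q %| f^`() by apply: (@dvdp_deriv_exp q 1).
have [s2|s2] := ltnP 2 (size q); first by constructor 3; exists q.
have sq : size q = 2%N by apply/eqP; rewrite eqn_leq s2 iq.1.
pose a := - q`_0.
have qE : q = 'X - a%:P.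
  have l1 : q`_1 = 1 by move/monicP: mq; rewrite lead_coefE sq.
  apply/polyP => -[|[|i]]; rewrite coefB coefX coefC //= ?sub0r ?opprK ?subr0 //.
  by rewrite nth_default ?sq // oppr0.
have [q3|nq3] := boolP (q ^+ 3 %| f).
  constructor 3; exists (q ^+ 2); split.
  - exact: monic_exp.
  - by rewrite expr2 size_Mmonic ?monic_neq0 // sq.
  - by apply: dvdp_trans q3; rewrite dvdp_exp2l.
  - exact: dvdp_deriv_exp.
have [H|H] := pselect (forall q', q' \is monic -> irreducible_poly q' -> q' != q ->
    ~~ (q' ^+ 2 %| f)).
  by constructor 2; exists a; rewrite /simple_double -qE; split.
have [q' [mq' iq' nq' q'2]] : exists q', [/\ q' \is monic, irreducible_poly q',
    q' != q & q' ^+ 2 %| f].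
  apply: contrapT => H'; apply: H => q' mq' iq' nq; apply/negP => q'2.
  by apply: H'; exists q'.
have cop : coprimep q q'.
  rewrite irreducible_poly_coprime //; apply: contra nq' => d.
  by rewrite (monic_irreducible_eq mq mq' iq iq' d).
constructor 3; exists (q * q'); split.
- by rewrite monicMl.
- by rewrite size_Mmonic ?monic_neq0 // sq /= ; have := iq'.1; case: size => [|[|]].
- by rewrite Gauss_dvdp // qf (dvdp_trans _ q'2) // expr2 dvdp_mulr.
- by rewrite Gauss_dvdp // qf' (@dvdp_deriv_exp q' 1).
Qed.

Lemma simple_doubleE a f : simple_double a f ->
  exists g, [/\ f = ('X - a%:P) ^+ 2 * g, g.[a] != 0 & sqfree g].
Proof.
move=> [/dvdpP[g ->]]; rewrite mulrC => n3 H; exists g.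
have ga : g.[a] != 0.
  by apply: contra n3 => /eqP g0; rewrite exprSr dvdp_mul2l ?expf_neq0 ?polyXsubC_eq0 //
    dvdp_XsubCl /root g0.
split=> // q mq iq; have [->|nq] := eqVneq q ('X - a%:P).
  apply: contra ga; rewrite expr2 => /dvdpP[s ->].
  by rewrite !hornerM hornerXsubC subrr !mulr0.
by apply: contra (H q mq iq nq) => d; rewrite dvdp_mull.
Qed.

(** A Bezout relation u f + v g = 1 makes multiplication by v an inverse of multiplication by g. *)
Lemma det_modmul_coprime n f g : f \is monic -> size f = n.+1 -> coprimep f g ->
  \det (modmul_mx n f g) != 0.
Proof.
move=> mf sf /Bezout_eq1_coprimepP[[u v] /= uv].
have : modmul_mx n f v *m modmul_mx n f g = 1%:M.
  rewrite -modmul_mxM //; have -> : v * g = (- u) * f + 1 by rewrite -uv; ring.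
  rewrite modmul_mxD // (modmul_mxC 1) // modmul_mx0 ?add0r //.
  exact: Pdiv.RingMonic.rmodp_mull.
move=> /(congr1 determinant); rewrite det_mulmx det1 => E.
by apply: contra_eq_neq E => ->; rewrite mulr0 eq_sym oner_eq0.
Qed.

End SquareFactors.

Lemma horner_taylor1 (A : comNzRingType) (f : {poly A}) x y :
  exists z, f.[x + y] = f.[x] + y * f^`().[x] + y ^+ 2 * z.
Proof.
elim/poly_ind: f => [|f c [z IH]]; first by exists 0; rewrite deriv0 !horner0; ring.
exists (f^`().[x] + z * (x + y)).
by rewrite derivD derivM derivX derivC !hornerE IH; ring.
Qed.

(** * Local analysis of the discriminant *)

Section Local.
Variables (p : nat) (pr : prime p) (A : comNzRingType) (r : {rmorphism A -> 'F_p}).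
Hypothesis rker : forall x, r x = 0 -> exists y, x = p%:R * y.
Hypothesis preg : forall x : A, p%:R * x = 0 -> x = 0.
Implicit Types (x : A) (f g : {poly A}).

Definition liftF (c : 'F_p) : A := (c : nat)%:R.

Lemma liftFK : cancel liftF r.
Proof. by move=> c; rewrite /liftF rmorph_nat natr_Zp. Qed.

Lemma liftF1 : liftF 1 = 1.
Proof. by rewrite /liftF /= modn_small. Qed.

Lemma r_p : r p%:R = 0.
Proof. by rewrite rmorph_nat pchar_Fp_0. Qed.

Definition dvd_psq x := exists y, x = p%:R ^+ 2 * y.

Lemma dvd_psqD x y : dvd_psq (x + p%:R ^+ 2 * y) <-> dvd_psq x.
Proof.
split=> [[z E]|[z ->]]; last by exists (z + y); rewrite mulrDr.
by exists (z - y); rewrite mulrBr -E addrK.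
Qed.

(** As [y] is a multiple of p, one factor p cancels by regularity, and what remains is a congruence
    modulo p, where [x] becomes a nonzero element of a field. *)
Lemma dvd_psqMl x y : r x != 0 -> r y = 0 -> dvd_psq (x * y) <-> dvd_psq y.
Proof.
move=> rx /rker[z ->]; split=> [[t E]|[t ->]]; last by exists (x * t); rewrite mulrCA.
have /preg : p%:R * (x * z - p%:R * t) = 0.
  by rewrite mulrBr mulrCA E expr2 mulrA subrr.
move/eqP; rewrite subr_eq0 => /eqP/(congr1 r)/eqP.
rewrite !rmorphM r_p mul0r mulf_eq0 (negPf rx) => /eqP/rker[u ->].
by exists u; rewrite mulrA expr2.
Qed.

Lemma not_dvd_psq x : r x != 0 -> ~ dvd_psq x.
Proof. by move=> rx [y E]; move: rx; rewrite E rmorphM rmorphXn r_p expr0n mul0r eqxx. Qed.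

Lemma det_modmul_unit n f g : f \is monic -> size f = n.+1 ->
  coprimep (map_poly r f) (map_poly r g) -> r (\det (modmul_mx n f g)) != 0.
Proof.
move=> mf sf cop; rewrite -det_map_mx map_modmul_mx // det_modmul_coprime //.
  exact: monic_map.
by rewrite size_map_monic.
Qed.

(* Replacing the last two rows of the matrix by the products of [g] with
   multiples of the lift of [fbar / w] is a unipotent operation, and makes
   these rows divisible by [p]. *)
Lemma det_modmul_double n f g w : f \is monic -> size f = n.+1 ->
  w \is monic -> (2 < size w)%N -> w %| map_poly r f -> w %| map_poly r g ->
  dvd_psq (\det (modmul_mx n f g)).
Proof.
move=> mf sf mw sw /dvdpP[s fE] /dvdpP[t gE].
have ms : s \is monic by rewrite -(monicMr _ mw) -fE monic_map.
have := size_map_monic r mf; rewrite fE sf size_Mmonic ?monic_neq0 // => ssw.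
have s0 : (0 < size s)%N by rewrite size_poly_gt0 monic_neq0.
(* The power of X raises the degree to exactly n - 2, so that [s1] and X [s1] fill the last two
   degrees below n, while both remain multiples of [s]. *)
pose s1 := s * 'X^(size w - 3).
have ms1 : s1 \is monic by rewrite monicMr ?monicXn.
have ss1 : (size s1).+1 = n.
  rewrite size_Mmonic ?monicXn ?monic_neq0 // size_polyXn.
  by move: (size s) (size w) ssw s0 sw => a b; lia.
have [m sm] : exists m, size s1 = m.+1.
  by exists (size s1).-1; rewrite prednK // size_poly_gt0 monic_neq0.
rewrite sm in ss1; subst n.
pose st := \poly_(i < m.+1) liftF s1`_i.
have rst : map_poly r st = s1.
  apply/polyP => i; rewrite coef_map coef_poly; case: ltnP => H; first by rewrite /= liftFK.
  by rewrite nth_default ?sm //; exact: rmorph0.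
(* The entry [u i] is monic of degree i, hence the base change [P] is lower unitriangular; only its
   last two rows differ from the monomial basis. *)
pose u i := if (i < m)%N then 'X^i else 'X^(i - m) * st.
have su (i : 'I_m.+2) : (size (u i) <= m.+2)%N.
  rewrite /u; case: ifP => H; first by rewrite size_polyXn ltnW // ltnS ltnW.
  apply: leq_trans (size_polyMleq _ _) _; rewrite size_polyXn.
  by have := size_poly m.+1 (fun i => liftF s1`_i); have := ltn_ord i; rewrite -/st; lia.
pose P : 'M[A]_m.+2 := \matrix_i poly_rV (u i).
have detP : \det P = 1.
  rewrite det_trig.
    rewrite big1 // => i _; rewrite !mxE /u; case: ltnP => H; first by rewrite coefXn eqxx.
    rewrite coefXnM ltnNge leq_subr /= subKn // coef_poly ltnSn.
    by move/monicP: ms1; rewrite lead_coefE sm => ->; rewrite liftF1.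
  apply/is_trig_mxP => i j ij; rewrite !mxE /u; case: ltnP => H.
    by rewrite coefXn gtn_eqF.
  rewrite coefXnM coef_poly; case: ifP => // _.
  by rewrite ifF //; lia.
have PM i : row i (P *m modmul_mx m.+2 f g) = poly_rV (Pdiv.CommonRing.rmodp (u i * g) f).
  by rewrite row_mul rowK mul_rV_modmul_mx.
pose d (i : nat) : A := if (i < m)%N then 1 else p%:R.
have /choice[h hP] : forall ij : 'I_m.+2 * 'I_m.+2, exists y,
    (P *m modmul_mx m.+2 f g) ij.1 ij.2 = d ij.1 * y.
  move=> [i j] /=; rewrite /d; case: ltnP => H; first by eexists; rewrite mul1r.
  apply: rker; have -> : (P *m modmul_mx m.+2 f g) i j =
      (Pdiv.CommonRing.rmodp (u i * g) f)`_j.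
    by have /rowP/(_ j) := PM i; rewrite !mxE.
  rewrite -coef_map map_rmodp_monic // rmorphM /= gE /u ltnNge H rmorphM /= rst.
  rewrite map_polyXn; have -> : 'X^(i - m) * s1 * (t * w) =
      ('X^(i - m) * 'X^(size w - 3) * t) * map_poly r f by rewrite fE /s1; ring.
  by rewrite Pdiv.RingMonic.rmodp_mull ?monic_map // coef0.
have E : P *m modmul_mx m.+2 f g =
    diag_mx (\row_i d i) *m \matrix_(i, j) h (i, j).
  by apply/matrixP => i j; rewrite mul_diag_mx (hP (i, j)) !mxE.
exists (\det (\matrix_(i, j) h (i, j))).
have -> : \det (modmul_mx m.+2 f g) = \det (P *m modmul_mx m.+2 f g).
  by rewrite det_mulmx detP mul1r.
rewrite E det_mulmx det_diag; congr (_ * _).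
rewrite !big_ord_recr /= !mxE /d /= ltnn ltnNge leqnSn /= big1 ?mul1r ?expr2 //.
by move=> i _; rewrite mxE /= ltn_ord.
Qed.

(* A Newton step on [f'] instead of [f]: it leaves [f] unchanged modulo [p^2],
   as [f'] vanishes modulo [p]. *)
Lemma exists_newton_shift f x : r f^`().[x] = 0 -> r f^`()^`().[x] != 0 ->
  exists x' y, [/\ r x' = r x, dvd_psq f^`().[x'] & f.[x'] = f.[x] + p%:R ^+ 2 * y].
Proof.
(* With f'(x) = p b, moving x by p H changes b into b + H f''(x) modulo p, and [H] is the solution
   modulo p of the vanishing of this expression. *)
move=> /rker[b bE] coefs_neq0; pose H := liftF (- r b / r f^`()^`().[x]).
have [z zE] := horner_taylor1 f x (p%:R * H).
have [t tE] := horner_taylor1 f^`() x (p%:R * H).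
have [c cE] : exists c, b + H * f^`()^`().[x] = p%:R * c.
  by apply: rker; rewrite rmorphD rmorphM liftFK divfK // subrr.
exists (x + p%:R * H), (H * b + H ^+ 2 * z); split.
- by rewrite rmorphD rmorphM r_p mul0r addr0.
- exists (c + H ^+ 2 * t); rewrite tE bE.
  move: (p%:R : A) cE => P cE.
  transitivity (P * (b + H * f^`()^`().[x]) + (P * H) ^+ 2 * t); first by ring.
  by rewrite cE; ring.
- by rewrite zE bE; move: (p%:R : A) => P; ring.
Qed.

(* At a lift [x'] killing [f'] modulo [p^2], one has [f' = l (X - x')] modulo
   [p^2], where [l] is coprime to [f] modulo [p] and [X - x'] contributes
   [f(x')] to the determinant. *)
Lemma det_modmul_deriv_simple n f x (g : {poly 'F_p}) : odd p -> f \is monic -> size f = n.+1 ->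
  map_poly r f = ('X - (r x)%:P) ^+ 2 * g -> g.[r x] != 0 -> sqfree g ->
  dvd_psq (\det (modmul_mx n f f^`())) <-> dvd_psq f.[x].
Proof.
move=> op mf sf fE ga sg; set a := r x.
(* Oddness of p enters here: f''(a) = 2 g(a) modulo p must not vanish, both for the Newton step and
   for the coprimality of [f] and [l]. *)
have nz2 : 2%:R != 0 :> 'F_p.
  rewrite -(dvdn_pcharf (pchar_Fp pr)); apply: contraL op => /(dvdn_leq (isT : 0 < 2)%N).
  by have := prime_gt1 pr; case: (p) => [|[|[|]]].
have f'E : map_poly r f^`() = (2%:R *: g + ('X - a%:P) * g^`()) * ('X - a%:P).
  rewrite -deriv_map fE derivM deriv_exp /= derivXsubC scaler_nat -mulr_natl; ring.
have rh q y : r q.[y] = (map_poly r q).[r y] by rewrite horner_map.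
have r0 : r f.[x] = 0 by rewrite rh fE !hornerE subrr expr0n !mul0r.
have r1 : r f^`().[x] = 0 by rewrite rh f'E hornerM hornerXsubC subrr mulr0.
have r2 : r f^`()^`().[x] != 0.
  rewrite rh -deriv_map f'E derivM derivXsubC mulr1 hornerD hornerM hornerXsubC.
  by rewrite subrr mulr0 add0r hornerD hornerZ hornerM hornerXsubC subrr mul0r addr0 mulf_neq0.
have [x' [y [rx' [c cE] fx']]] := exists_newton_shift r1 r2.
have /factor_theorem[l lE] : root (f^`() - (f^`().[x'])%:P) x'.
  by rewrite /root !hornerE subrr.
have lbar : map_poly r l = 2%:R *: g + ('X - a%:P) * g^`().
  have nX : 'X - a%:P != 0 by rewrite polyXsubC_eq0.
  apply: (mulIf nX); rewrite -f'E.
  have := congr1 (map_poly r) lE; rewrite rmorphB rmorphM /= map_polyC /= map_polyXsubC rx'.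
  by move=> <-; rewrite cE rmorphM rmorphXn r_p expr0n mul0r polyC0 subr0.
(* At a, the reduction 2 g + (X - a) g' of [l] takes the value 2 g(a), which is nonzero; modulo g it
   is (X - a) g', which is prime to g because g is squarefree with g(a) nonzero. *)
have copl : coprimep (map_poly r f) (map_poly r l).
  rewrite fE lbar coprimepMl coprimep_expl //=; last first.
    by rewrite coprimep_sym coprimep_XsubC /root !hornerE subrr mul0r addr0 mulf_neq0.
  rewrite -mul_polyC coprimep_addl_mul coprimepMr coprimep_XsubC /root ga /=.
  apply: contraT => /(not_coprime_deriv_sq pr)[|q [mq iq q2]].
    by apply: contraNneq ga => ->; rewrite horner0.
  by have := sg q mq iq; rewrite q2.
have f'E' : f^`() = l * ('X - x'%:P) + (p%:R ^+ 2 * c)%:P by rewrite -cE -lE subrK.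
rewrite {1}f'E' modmul_mxD // modmul_mxM // modmul_mxC // -scale_scalar_mx.
have [z ->] := det_add_scale (modmul_mx n f l *m modmul_mx n f ('X - x'%:P)) c%:M (p%:R ^+ 2).
rewrite det_mulmx det_modmul_XsubC // dvd_psqD mulrA fx'.
rewrite dvd_psqMl ?dvd_psqD //.
  by rewrite rmorphM rmorph_sign mulf_neq0 ?signr_eq0 ?det_modmul_unit.
by rewrite rmorphD rmorphM rmorphXn r_p expr0n mul0r addr0.
Qed.

Theorem dvd_psq_det_simple n f a : odd p -> f \is monic -> size f = n.+1 ->
  simple_double a (map_poly r f) ->
  dvd_psq (\det (modmul_mx n f f^`())) <-> dvd_psq f.[liftF a].
Proof.
move=> op mf sf /simple_doubleE[g [fE ga sg]].
by apply: det_modmul_deriv_simple (sg); rewrite ?liftFK.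
Qed.

Theorem not_dvd_psq_det_sqfree n f : f \is monic -> size f = n.+1 ->
  sqfree (map_poly r f) -> ~ dvd_psq (\det (modmul_mx n f f^`())).
Proof.
move=> mf sf sq; apply: not_dvd_psq; apply: det_modmul_unit => //.
rewrite -deriv_map; apply: contraT => /(not_coprime_deriv_sq pr)[|q [mq iq q2]].
  by rewrite monic_neq0 // monic_map.
by have := sq q mq iq; rewrite q2.
Qed.

End Local.

(** * The square sieve *)

Section Sieve.
Import mathcomp.boot.fintype mathcomp.boot.finset.

(** This is the expansion of the product over [T] of 1 - [i in S], in which each element of [S]
    contributes a zero factor. *)
Lemma sum_subset_sign (R : comNzRingType) (T : finType) (S : {set T}) :
  \sum_(I : {set T} | I \subset S) (-1) ^+ #|I| = (S == set0)%:R :> R.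
Proof.
have := @bigA_distr R 0 1 *%R +%R T (fun i => - (i \in S)%:R) (fun=> 1).
rewrite (_ : \big[_/_]_i _ = (S == set0)%:R); last first.
  have [->|/set0Pn[x xS]] := eqVneq S set0.
    by rewrite big1 // => i _; rewrite inE oppr0; exact: add0r.
  by rewrite (bigD1 x) //= xS [X in X * _]addNr mul0r.
move=> ->; rewrite [RHS](bigID (fun I : {set T} => I \subset S)) /=.
rewrite [X in _ + X]big1 ?addr0; last first.
  move=> I /subsetPn[x xI xS]; rewrite (bigD1 x) //= xI (negPf xS) oppr0.
  exact: mul0r.
apply: eq_big => [I //|I].
move=> /subsetP IS; rewrite -big_mkcond /= -prodr_const; apply: eq_bigr => i iI.
by rewrite IS.
Qed.

Variables (F : finFieldType) (n : nat).
Notation T := {poly_n.+1 F}.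
Notation q := #|F|.
Implicit Types (I J E : {set T}) (f u : {poly F}).

(** The bound n on the degrees makes the family finite, yet it contains every irreducible factor of
    a nonzero polynomial of degree at most n. *)
Definition monic_irrs : {set T} := [set t : T | ((t : {poly F}) \is monic) && irreducibleb
  (t : {poly F})].

Lemma monic_irrsP (t : T) : reflect ((t : {poly F}) \is monic /\ irreducible_poly (t :
  {poly F})) (t \in monic_irrs).
Proof.
by rewrite inE; apply: (iffP andP) => -[mt /irreducibleP it].
Qed.

(** Sets of irreducibles encode squarefree monic polynomials, and the sign of the cardinal of [I] is
    the Moebius function at [prodI I]. *)
Definition prodI I : {poly F} := \prod_(t in I) (t : {poly F}).

Lemma prodI_monic I : I \subset monic_irrs -> prodI I \is monic.
Proof. by move=> /subsetP sI; apply: monic_prod => t /sI/monic_irrsP[]. Qed.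

Lemma irr_dvd_prodI I (t : T) : I \subset monic_irrs -> t \in monic_irrs ->
  ((t : {poly F}) %| prodI I) = (t \in I).
Proof.
move=> /subsetP sI /monic_irrsP[mt it]; apply/idP/idP => [|tI]; last first.
  by rewrite /prodI (bigD1 t) //= dvdp_mulr.
rewrite /prodI; elim/big_rec: _ => [|t' x t'I IH].
  by rewrite dvdp1 => /eqP e; case: it; rewrite e.
rewrite irreducible_dvdM // => /orP[d|/IH//].
have /monic_irrsP[mt' it'] := sI _ t'I.
by rewrite (_ : t = t') //; apply/val_inj; exact: monic_irreducible_eq d.
Qed.

Lemma prodI_setU1 I t : t \notin I -> prodI (t |: I) = (t : {poly F}) * prodI I.
Proof. by move=> tI; rewrite /prodI big_setU1. Qed.

Lemma prodI_exp_dvd I k f : I \subset monic_irrs ->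
  (prodI I ^+ k %| f) = [forall t in I, (t : {poly F}) ^+ k %| f].
Proof.
move: {2}#|I| (leqnn #|I|) => m; elim: m I => [|m IH] I.
  rewrite leqn0 cards_eq0 => /eqP-> _; rewrite /prodI big_set0 expr1n dvd1p.
  by apply/esym/forallP => t; rewrite inE.
move=> cI sI; have [->|/set0Pn[t tI]] := eqVneq I set0.
  rewrite /prodI big_set0 expr1n dvd1p.
  by apply/esym/forallP => t; rewrite inE.
have sI' : I :\ t \subset monic_irrs by apply: subset_trans sI; exact: subD1set.
have ti : t \in monic_irrs by apply: (subsetP sI).
rewrite -(setD1K tI) prodI_setU1 ?setD11 // exprMn Gauss_dvdp; last first.
  apply/coprimep_expl/coprimep_expr; have /monic_irrsP[_ it] := ti.
  by rewrite irreducible_poly_coprime // irr_dvd_prodI // setD11.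
rewrite IH //; last by move: cI; rewrite (cardsD1 t) tI.
apply/andP/forall_inP => [[tf /forall_inP H] t'|H].
  by case/setU1P => [->//|]; exact: H.
split; first by apply: H; rewrite setU11.
by apply/forall_inP => t' t'I; apply: H; rewrite setU1r.
Qed.

Lemma prodI_inj I J : I \subset monic_irrs -> J \subset monic_irrs -> prodI I = prodI J ->
  I = J.
Proof.
move=> sI sJ e; apply/setP => t.
have [ti|nti] := boolP (t \in monic_irrs); first by rewrite -(irr_dvd_prodI sI ti)
  -(irr_dvd_prodI sJ ti) e.
by rewrite (contraNF (subsetP sI t) nti) (contraNF (subsetP sJ t) nti).
Qed.

Lemma size_prodI_gt0 I : I \subset monic_irrs -> (0 < size (prodI I))%N.
Proof. by move=> sI; rewrite size_poly_gt0 monic_neq0 // prodI_monic. Qed.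

Lemma size_prodI1 I : I \subset monic_irrs -> (size (prodI I) == 1%N) = (I == set0).
Proof.
move=> sI; apply/idP/eqP => [/eqP s1|->]; last by rewrite /prodI big_set0 size_poly1.
apply/eqP; apply: contraT => /set0Pn[t tI].
have ti : t \in monic_irrs by apply: (subsetP sI).
have := irr_dvd_prodI sI ti; rewrite tI => /dvdp_leq.
rewrite monic_neq0 ?prodI_monic // s1 => /(_ isT).
by have /monic_irrsP[_ [st _]] := ti; rewrite leqNgt st.
Qed.

Variable R : realFieldType.

(** The k-th power of [prodI I] divides [f] exactly when [I] consists of irreducibles whose k-th
    powers divide [f], so the sum runs over the subsets of a fixed set. The case k = 1 serves to
    compute Moebius sums, k = 2 is the square sieve. *)
Lemma sum_sign_dvd E k f :
  \sum_(I : {set T} | I \subset monic_irrs :\: E) (-1) ^+ #|I| * (prodI I ^+ k %| f)%R%:R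
  = [forall t in monic_irrs :\: E, ~~ ((t : {poly F}) ^+ k %| f)]%R%:R :> R.
Proof.
pose S := [set t in monic_irrs :\: E | (t : {poly F}) ^+ k %| f].
transitivity (\sum_(I : {set T} | I \subset S) (-1) ^+ #|I| : R).
  rewrite [RHS](eq_bigl (fun I => (I \subset monic_irrs :\: E) && (prodI I ^+ k %| f))).
    by rewrite [RHS]big_mkcondr /=; apply: eq_bigr => I _; case: (_ %| _); rewrite ?mulr1
      ?mulr0.
  move=> I; apply/subsetP/andP => [H|[sI]].
    have sI : I \subset monic_irrs :\: E by apply/subsetP => t /H; rewrite inE => /andP[].
    split=> //; rewrite prodI_exp_dvd; last by rewrite (subset_trans sI) ?subsetDl.
    by apply/forall_inP => t /H; rewrite inE => /andP[].
  rewrite prodI_exp_dvd; last by rewrite (subset_trans sI) ?subsetDl.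
  by move=> /forall_inP H t tI; rewrite inE H // (subsetP sI).
rewrite sum_subset_sign; congr ((nat_of_bool _)%:R); apply/eqP/forall_inP => [S0 t ti|H].
  apply/negP => d; have : t \in S by rewrite inE ti d.
  by rewrite S0 inE.
by apply/setP => t; rewrite inE [RHS]inE; apply/negP => /andP[/H/negP].
Qed.

Definition monicpoly N (a : 'rV[F]_N) : {poly F} := 'X^N + rVpoly a.

Lemma size_rVpoly N (a : 'rV[F]_N) : (size (rVpoly a) <= N)%N.
Proof. exact: size_poly. Qed.

Lemma size_monicpoly N a : size (@monicpoly N a) = N.+1.
Proof. by rewrite size_polyDl size_polyXn // ltnS size_rVpoly. Qed.

Lemma monicpoly_monic N a : @monicpoly N a \is monic.
Proof.
by rewrite monicE lead_coefDl ?lead_coefXn // size_polyXn ltnS size_rVpoly.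
Qed.

Lemma monicpoly_inj N : injective (@monicpoly N).
Proof. by move=> a b /addrI/(congr1 (@poly_rV F N)); rewrite !rVpolyK. Qed.

Lemma monicpoly_surj N f : f \is monic -> size f = N.+1 -> exists a, f = @monicpoly N a.
Proof.
move=> mf sf; exists (poly_rV (f - 'X^N)); rewrite /monicpoly poly_rV_K.
  by rewrite addrC subrK.
apply/leq_sizeP => j; rewrite leq_eqVlt coefB coefXn => /predU1P[<-|lt].
  by move: mf; rewrite monicE lead_coefE sf /= => /eqP->; rewrite eqxx subrr.
by rewrite gtn_eqF // nth_default ?subrr // sf.
Qed.

Lemma card_monic_multiples u j N : u \is monic -> size u = j.+1 -> (j <= N)%N ->
  #|[set a : 'rV[F]_N | u %| monicpoly a]| = (q ^ (N - j))%N.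
Proof.
move=> mu su jN.
have /choice[g gE] : forall b : 'rV[F]_(N - j), exists a : 'rV[F]_N,
    monicpoly a = u * monicpoly b.
  move=> b.
  have [||a ->] := @monicpoly_surj N (u * monicpoly b); last by exists a.
    by rewrite monicMl ?monicpoly_monic.
  by rewrite size_Mmonic ?monicpoly_monic ?monic_neq0 // su size_monicpoly addSn addnS /=
    subnKC.
have <- : [set g b | b : 'rV[F]_(N - j)] = [set a | u %| monicpoly a].
  apply/setP => a; rewrite inE; apply/imsetP/idP => [[b _ ->]|/dvdpP[v vE]].
    by rewrite gE dvdp_mulr.
  have mv : v \is monic by rewrite -(monicMr _ mu) -vE monicpoly_monic.
  have [|b bE] := @monicpoly_surj (N - j) v mv.
    have := size_monicpoly a; rewrite vE size_Mmonic ?monic_neq0 // su addnS /=.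
    have sv : (0 < size v)%N by rewrite size_poly_gt0 monic_neq0.
    by move: (size v) sv => s; lia.
  by exists b => //; apply: monicpoly_inj; rewrite gE -bE vE mulrC.
rewrite card_imset ?card_mx ?mul1n // => b b' e; apply: monicpoly_inj.
by apply: (mulfI (monic_neq0 mu)); rewrite -!gE e.
Qed.

(* The sum of the Moebius function over the monic polynomials of degree [d]
   with no irreducible factor in [E] (of degree at most [n]). *)
Definition signed_count E d : R :=
  \sum_(I : {set T} | (I \subset monic_irrs :\: E) && (size (prodI I) == d.+1)) (-1) ^+ #|I|.

(** By unique factorisation [prodI] is injective, and there are q^d monic polynomials of degree
    d. *)
Lemma card_prodI E d : (#|[set I : {set T} | (I \subset monic_irrs :\: E) &&
  (size (prodI I) == d.+1)]| <= q ^ d)%N.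
Proof.
have <- : #|{: 'rV[F]_d}| = (q ^ d)%N by rewrite card_mx mul1n.
have /choice[g gE] : forall I, exists a : 'rV[F]_d, I \subset monic_irrs ->
    size (prodI I) = d.+1 -> prodI I = monicpoly a.
  move=> I.
  have [sI|] := boolP (I \subset monic_irrs); last by exists 0.
  have [s|] := eqVneq (size (prodI I)) d.+1; last by exists 0 => // _ /eqP; rewrite (negPf i).
  by have [a ->] := monicpoly_surj (prodI_monic sI) s; exists a.
apply: (@leq_card_in _ _ g) => I J.
rewrite !inE => /andP[sI /eqP szI] /andP[sJ /eqP szJ] e.
have {}sI : I \subset monic_irrs by rewrite (subset_trans sI) ?subsetDl.
have {}sJ : J \subset monic_irrs by rewrite (subset_trans sJ) ?subsetDl.
by apply: prodI_inj => //; rewrite (gE I) // (gE J) // e.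
Qed.

Lemma sum_prodI_size E N (G : {set T} -> R) :
  (forall I, I \subset monic_irrs :\: E -> (N < (size (prodI I)).-1)%N -> G I = 0) ->
  \sum_(I : {set T} | I \subset monic_irrs :\: E) G I =
  \sum_(0 <= d < N.+1) \sum_(I : {set T} | (I \subset monic_irrs :\: E) && (size (prodI I)
    == d.+1)) G I.
Proof.
move=> G0; under [RHS]eq_bigr do rewrite big_mkcondr.
rewrite exchange_big /=; apply: eq_bigr => I sI.
have s0 : (0 < size (prodI I))%N by rewrite size_prodI_gt0 // (subset_trans sI) ?subsetDl.
have [le|gt] := leqP (size (prodI I)).-1 N.
  rewrite (bigD1_seq (size (prodI I)).-1) ?iota_uniq ?mem_index_iota //= prednK // eqxx.
  rewrite big1 ?addr0 // => d nd; case: eqP => // e; by rewrite e eqxx in nd.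
rewrite G0 // big_nat_cond big1 // => d /andP[/andP[_ dN] _].
by case: eqP => // e; move: gt dN; rewrite e /= ltnS; lia.
Qed.

(** Double counting of the pairs (a, I) with [prodI I] dividing a monic polynomial a of degree N:
    the inner sum vanishes as soon as a has an irreducible factor. This is the coefficient of T^N in
    (1/zeta) zeta = 1; the bound on N keeps all irreducible factors inside [monic_irrs]. *)
Lemma signed_count_conv N : (N <= n)%N ->
  \sum_(0 <= j < N.+1) signed_count set0 j * q%:R ^+ (N - j) = (N == 0%N)%:R.
Proof.
move=> Nn; transitivity (\sum_(a : 'rV[F]_N)
    \sum_(I : {set T} | I \subset monic_irrs :\: set0) (-1) ^+ #|I| * (prodI I ^+ 1 %|
      monicpoly a)%R%:R : R).
  rewrite exchange_big /= (@sum_prodI_size set0 N) => [|I sI gt]; last first.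
    rewrite big1 // => a _; rewrite expr1; case: (boolP (_ %| _)) => [/dvdp_leq|_]; last by
      rewrite mulr0.
    move=> /(_ (monic_neq0 (monicpoly_monic a))); rewrite size_monicpoly => H.
    by exfalso; move: gt H; case: (size _) => [|s] //= gt; rewrite ltnS leqNgt gt.
  apply: eq_big_nat => j /andP[_ jN]; rewrite mulr_suml.
  apply: eq_bigr => I /andP[sI /eqP sz]; rewrite -mulr_sumr; congr (_ * _).
  rewrite -natrX -(@card_monic_multiples (prodI I)) //; last first.
    by rewrite prodI_monic // (subset_trans sI) ?subsetDl.
  rewrite expr1 -sum1_card natr_sum big_mkcond /=; apply: eq_bigr => a _.
  by rewrite inE; case: ifP.
under eq_bigr do rewrite sum_sign_dvd.
case: N Nn => [|N] Nn.
  have all1 (a : 'rV[F]_0) : [forall t in monic_irrs :\: set0, ~~ ((t : {poly F}) ^+ 1 %|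
    monicpoly a)].
    apply/forall_inP => t; rewrite setD0 expr1 => /monic_irrsP[_ [st _]].
    apply/negP => /dvdp_leq; rewrite monic_neq0 ?monicpoly_monic // size_monicpoly => /(_ isT).
    by rewrite leqNgt st.
  under eq_bigr do rewrite all1.
  by rewrite sumr_const card_mx.
rewrite big1 // => a _; rewrite (_ : [forall t in _, _] = false) //.
apply/negP => /forall_inP H.
have [|t [mt it ta]] := @exists_monic_irreducible_dvd F (monicpoly a).
  by rewrite size_monicpoly.
have st : (size t <= n.+1)%N.
  by rewrite (leq_trans (dvdp_leq _ ta)) ?monic_neq0 ?monicpoly_monic // size_monicpoly.
have tE := npolypK st.
have := H (npolyp n.+1 t); rewrite setD0 tE expr1 ta => /(_ _)/negP; apply=> //.
by apply/monic_irrsP; rewrite tE.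
Qed.

Lemma signed_count0 E : signed_count E 0 = 1.
Proof.
rewrite /signed_count (big_pred1 set0) ?cards0 // => I.
have [sI|nsI] := boolP (I \subset monic_irrs :\: E).
  by rewrite size_prodI1 // (subset_trans sI) ?subsetDl.
by apply/esym/eqP => e; move: nsI; rewrite e sub0set.
Qed.

(* Split according to whether [t] divides: the generating series gets multiplied
   by [1 / (1 - T)] each time a linear polynomial is excluded. *)
Lemma signed_countS E (t : T) d : t \in monic_irrs -> t \notin E -> size (t : {poly F}) = 2%N ->
  signed_count E d.+1 = signed_count (t |: E) d.+1 - signed_count (t |: E) d.
Proof.
move=> ti tE st; rewrite /signed_count (bigID (fun I : {set T} => t \in I)) /= addrC.
congr (_ + _).
  apply: eq_bigl => I; rewrite andbAC; congr (_ && _); apply/andP/idP => [[sI tI]|sI].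
    apply/subsetP => x xI; have := subsetP sI x xI; rewrite !in_setD in_setU1 negb_or =>
      /andP[-> ->].
    by rewrite !andbT; apply: contraNneq tI => <-.
  split; last by apply/negP => /(subsetP sI); rewrite !inE eqxx.
  by rewrite (subset_trans sI) // setDS // subsetUr.
rewrite (reindex_onto (fun J => t |: J) (fun I => I :\ t)) /= => [|I /andP[_ tI]]; last first.
  exact: setD1K.
rewrite -sumrN; apply: eq_big => [J|J /andP[]]; last first.
  move=> _ /eqP e; have tJ : t \notin J by rewrite -e setD11.
  by rewrite cardsU1 tJ exprS mulN1r.
rewrite setU11 andbT; have [tJ|tJ] /= := boolP (t \in J).
  rewrite (_ : (_ == J) = false) ?andbF; last first.
    by apply/eqP => e; move: tJ; rewrite -e setD11.
  by rewrite (_ : (J \subset _) = false) //; apply/negP => /subsetP/(_ t tJ); rewrite !inE eqxx.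
rewrite setU1K // eqxx andbT.
have -> : (t |: J \subset monic_irrs :\: E) = (J \subset monic_irrs :\: (t |: E)).
  apply/subsetP/subsetP => H x.
    move=> xJ; have := H x (setU1r _ xJ); rewrite !in_setD in_setU1 negb_or => /andP[-> ->].
    by rewrite !andbT; apply: contraNneq tJ => <-.
  case/setU1P => [->|/H]; first by rewrite in_setD tE ti.
  by rewrite !in_setD in_setU1 negb_or => /andP[/andP[_ ->] ->].
case sJ : (J \subset _) => //=; rewrite prodI_setU1 //.
have mJ : prodI J \is monic by rewrite prodI_monic // (subset_trans sJ) ?subsetDl.
have /monic_irrsP[mt _] := ti.
by rewrite size_Mmonic ?monic_neq0 // st addnC addn2.
Qed.

(** Subtracting q times the convolution identity at d - 1 from the one at d isolates the last term.
    The generating series is thus 1 - qT, up to degree n. *)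
Lemma signed_count_set0 d : (1 < d <= n)%N -> signed_count set0 d = 0.
Proof.
case: d => [|[|d]] // /andP[_ dn].
have := signed_count_conv dn; rewrite big_nat_recr //= subnn expr0 mulr1 => /esym.
have -> : \sum_(0 <= j < d.+2) signed_count set0 j * q%:R ^+ (d.+2 - j) =
    q%:R * \sum_(0 <= j < d.+2) signed_count set0 j * q%:R ^+ (d.+1 - j) :> R.
  rewrite mulr_sumr; apply: eq_big_nat => j /andP[_ jd].
  by rewrite mulrCA -exprS subSn.
by rewrite (signed_count_conv (ltnW dn)) mulr0 add0r => <-.
Qed.

Lemma signed_count_set0_1 : (0 < n)%N -> signed_count set0 1 = - q%:R.
Proof.
move=> n0; have := signed_count_conv n0; rewrite !big_nat_recr //= big_nil add0r.
by rewrite signed_count0 mul1r expr1 subnn mulr1 => /eqP; rewrite addrC addr_eq0 => /eqP.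
Qed.

Lemma signed_count1 (t : T) d : t \in monic_irrs -> size (t : {poly F}) = 2%N -> (d < n)%N ->
  signed_count [set t] d.+1 = 1 - q%:R.
Proof.
move=> ti st; have S k := signed_countS k ti (negbT (in_set0 t)) st.
elim: d => [|d IH] dn.
  by have := S 0%N; rewrite setU0 signed_count0 signed_count_set0_1 // => /eqP; rewrite
    eq_sym subr_eq addrC => /eqP.
have := S d.+1; rewrite setU0 signed_count_set0 // IH 1?ltnW // => /eqP.
by rewrite eq_sym subr_eq0 => /eqP.
Qed.

(** The coefficient of T^d in (1 - qT)/(1 - T)^2 is (d + 1) - q d. *)
Lemma signed_count2 (t t' : T) d : t \in monic_irrs -> size (t : {poly F}) = 2%N ->
  t' \in monic_irrs -> size (t' : {poly F}) = 2%N -> t' != t -> (d <= n)%N ->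
  signed_count [set t'; t] d = 1 - (q%:R - 1) * d%:R.
Proof.
move=> ti st ti' st' ne; elim: d => [|d IH] dn.
  by rewrite signed_count0 mulr0 subr0.
have := signed_countS d ti' (_ : t' \notin [set t]) st'; rewrite inE => /(_ ne).
rewrite signed_count1 // IH 1?ltnW // => /eqP; rewrite eq_sym subr_eq => /eqP ->.
by rewrite -natr1; ring.
Qed.

(** Each density is replaced by its expected value q^(-2d-e), where d is the degree of [prodI I]; at
    most q^d sets share this d, and densities vanish once 2d + e exceeds n. Having X in [E] keeps
    every modulus prime to X, as the bound [del] requires. The factor [b] will be 1 or a power of a
    linear polynomial. *)
Lemma sieve_estimate (E : {set T}) (b : {poly F}) e (dens : {poly F} -> R) (del : nat -> R) :
  npolyp n.+1 'X \in E -> (0 < n)%N ->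
  b \is monic -> size b = e.+1 -> ~~ ('X %| b) ->
  (forall u d, u \is monic -> size u = d.+1 -> (d <= n)%N -> ~~ ('X %| u) ->
    `|dens u - (q%:R ^+ d)^-1| <= del d) ->
  (forall u, (n.+1 < size u)%N -> dens u = 0) ->
  `| \sum_(I : {set T} | I \subset monic_irrs :\: E) (-1) ^+ #|I| * dens (b * prodI I ^+ 2)
     - \sum_(0 <= d < n.+1 | (2 * d + e <= n)%N) signed_count E d * (q%:R ^+ (2 * d + e))^-1 |
  <= \sum_(0 <= d < n.+1 | (2 * d + e <= n)%N) q%:R ^+ d * del (2 * d + e)%N.
Proof.
move=> XE n0 mb sb Xb close big.
have szb I : I \subset monic_irrs :\: E ->
    size (b * prodI I ^+ 2) = (2 * (size (prodI I)).-1 + e).+1.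
  move=> sI; have sI' : I \subset monic_irrs by rewrite (subset_trans sI) ?subsetDl.
  have mI := prodI_monic sI'; have s0 := size_prodI_gt0 sI'.
  rewrite size_Mmonic ?monic_neq0 ?monic_exp // expr2 size_Mmonic ?monic_neq0 // sb.
  by move: (size _) s0 => a; lia.
have Xi : npolyp n.+1 'X \in monic_irrs.
  apply/monic_irrsP; rewrite npolypK ?size_polyX // monicX; split=> //.
  by rewrite -['X]subr0 -polyC0; exact: irredp_XsubC.
have XN I : I \subset monic_irrs :\: E -> ~~ ('X %| b * prodI I ^+ 2).
  move=> sI; have sI' : I \subset monic_irrs by rewrite (subset_trans sI) ?subsetDl.
  have /monic_irrsP[_] := Xi; rewrite npolypK ?size_polyX // => iX.
  rewrite expr2 !irreducible_dvdM // (negPf Xb) /= orbb.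
  have := irr_dvd_prodI sI' Xi; rewrite npolypK ?size_polyX // => ->.
  by apply/negP => /(subsetP sI); rewrite inE XE.
rewrite (@sum_prodI_size E n) => [|I sI gt]; last first.
  by rewrite big ?mulr0 // szb //; lia.
have -> : \sum_(0 <= d < n.+1) \sum_(I : {set T} | (I \subset monic_irrs :\: E) &&
      (size (prodI I) == d.+1)) (-1) ^+ #|I| * dens (b * prodI I ^+ 2) =
    \sum_(0 <= d < n.+1 | (2 * d + e <= n)%N) \sum_(I : {set T} | (I \subset monic_irrs :\:
      E) &&
      (size (prodI I) == d.+1)) (-1) ^+ #|I| * dens (b * prodI I ^+ 2).
  rewrite [RHS]big_mkcond; apply: eq_bigr => d _; case: ifPn => // ngt.
  rewrite big1 // => I /andP[sI /eqP sz].
  by rewrite big ?mulr0 // szb // sz /=; lia.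
rewrite -sumrB (le_trans (ler_norm_sum _ _ _)) // ler_sum // => d le.
rewrite /signed_count mulr_suml -sumrB (le_trans (ler_norm_sum _ _ _)) //.
apply: (@le_trans _ _ (\sum_(I : {set T} | (I \subset monic_irrs :\: E) && (size (prodI I)
  == d.+1)) del (2 * d + e)%N)).
  apply: ler_sum => I /andP[sI /eqP sz]; rewrite -mulrBr normrM normrX normrN1 expr1n mul1r.
  apply: close => //; last exact: XN.
    by rewrite monicMl // monic_exp // prodI_monic // (subset_trans sI) ?subsetDl.
  by rewrite szb // sz.
(* The modulus (X - 1)^(2d+e) is admissible, so [del] bounds an absolute value at this degree. *)
have del0 : 0 <= del (2 * d + e)%N.
  apply: le_trans (close (('X - 1%:P) ^+ (2 * d + e)) _ _ _ le _) => //.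
  - by rewrite monic_exp // monicXsubC.
  - by rewrite size_exp_XsubC.
  - have := dvdp_XsubCl (('X - 1%:P : {poly F}) ^+ (2 * d + e)) 0.
    rewrite polyC0 subr0 => ->; rewrite rootE horner_exp hornerXsubC sub0r.
    by rewrite expf_neq0 // oppr_eq0 oner_eq0.
rewrite sumr_const -[_ *+ _]mulr_natl ler_wpM2r // -natrX ler_nat.
by rewrite -[X in (X <= _)%N]cardsE; exact: card_prodI.
Qed.

End Sieve.

(** * Digits and Haar measure *)

Section Padic.
Variables (p : nat) (pr : prime p).
Implicit Types x y : padic_int p.

Let p0 : (0 < p)%N. Proof. exact: prime_gt0. Qed.
Let pk0 k : (0 < p ^ k)%N. Proof. by rewrite expn_gt0 p0. Qed.

Lemma Zp_cast_pow k : (Zp_trunc (p ^ k.+1)).+2 = (p ^ k.+1)%N.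
Proof. by rewrite Zp_cast // -{1}(exp1n k.+1) ltn_exp2r // prime_gt1. Qed.

Lemma val_Zp_pow k m : ((m%:R : 'Z_(p ^ k.+1)) : nat) = (m %% p ^ k.+1)%N.
Proof. by rewrite Zp_nat /= Zp_cast_pow. Qed.

Let Zp_pow_inj k (a b : 'Z_(p ^ k.+1)) : (a : nat) = b -> a = b.
Proof. exact: val_inj. Qed.

Let val_ZpD k (a b : 'Z_(p ^ k.+1)) : nat_of_ord (a + b) = ((nat_of_ord a + b) %% p ^ k.+1)%N.
Proof. by rewrite -{1}[a]natr_Zp -{1}[b]natr_Zp -natrD val_Zp_pow. Qed.

Let val_ZpM k (a b : 'Z_(p ^ k.+1)) : nat_of_ord (a * b) = ((nat_of_ord a * b) %% p ^ k.+1)%N.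
Proof. by rewrite -{1}[a]natr_Zp -{1}[b]natr_Zp -natrM val_Zp_pow. Qed.

Let Fp_mod1 m : (m %% p ^ 1)%N%:R = m%:R :> 'F_p.
Proof. by rewrite expn1 Fp_nat_mod. Qed.

Lemma padic_res_lt x k : ((x k : nat) < p ^ k.+1)%N.
Proof. by have := ltn_ord (x k); rewrite [X in (_ < X)%N -> _]Zp_cast_pow. Qed.

Lemma padic_res_mod x j k : (j <= k)%N -> (x j : nat) = (x k %% p ^ j.+1)%N.
Proof.
move=> /subnKC <-; elim: (k - j)%N => [|i IH]; first by rewrite addn0 modn_small ?padic_res_lt.
rewrite IH addnS (padic_resP x (j + i)) val_Zp_pow modn_dvdm //.
by rewrite dvdn_exp2l // ltnS leq_addr.
Qed.

Lemma padic_natr m k : (m%:R : padic_int p) k = m%:R.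
Proof. by elim: m => [//|m IH]; rewrite -!natr1 -IH. Qed.

(** The index is shifted by one because [x m] is the residue modulo p^(m+1). *)
Lemma padic_dvdP m x : padic_dvd m.+1 x <-> x m = 0.
Proof.
split=> [[y ->]|x0].
  rewrite -natrX -[LHS]/((_ : padic_int p) m * y m) padic_natr.
  by rewrite [_%:R](_ : _ = 0) ?mul0r //; apply: Zp_pow_inj; rewrite val_Zp_pow modnn.
have dv k : (p ^ m.+1 %| x (k + m.+1))%N.
  have := padic_res_mod x (leq_addl k m); rewrite x0 => e.
  have : (x m = 0%N :> nat) by rewrite x0.
  by rewrite (padic_res_mod x (_ : m <= k + m.+1)%N) => [/eqP //|]; rewrite addnS leqW //
    leq_addl.
(* The residue of index k + m + 1 is known modulo p^(k+m+2), so its quotient by p^(m+1) is known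
   modulo p^(k+1). *)
pose y k : 'Z_(p ^ k.+1) := ((x (k + m.+1) : nat) %/ p ^ m.+1)%:R.
have cy : padic_compat y.
  move=> k; apply: Zp_pow_inj; rewrite !val_Zp_pow modn_dvdm ?dvdn_exp2l //.
  rewrite (padic_res_mod x (_ : k + m.+1 <= k.+1 + m.+1)%N) ?leq_add2r //.
  set a := (x (k.+1 + m.+1) : nat).
  rewrite [in RHS](divn_eq a (p ^ (k + m.+1).+1)) -addSn expnD mulnA.
  by rewrite divnMDl // modnMDl.
exists (PadicInt cy); apply: padic_ext => k.
rewrite -natrX -[RHS]/((_ : padic_int p) k * y k) padic_natr /y -natrM mulnC divnK //.
by apply: Zp_pow_inj; rewrite val_Zp_pow -padic_res_mod // leq_addr.
Qed.

(** Multiplication by p loses one digit: the residue of [x] at index k is read off from that of p x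
    at index k + 1. *)
Lemma padic_mulp_inj x : p%:R * x = 0 -> x = 0.
Proof.
move=> px; apply: padic_ext => k; have : (p%:R * x) k.+1 = 0 by rewrite px.
rewrite -[LHS]/((_ : padic_int p) k.+1 * x k.+1) padic_natr -[x k.+1]natr_Zp -natrM.
move=> /(congr1 (@nat_of_ord _)); rewrite val_Zp_pow /= => /eqP.
rewrite -/(dvdn _ _) => d; have {}d : (p ^ k.+1 %| x k.+1)%N.
  by rewrite -(dvdn_pmul2l p0) -expnS.
by apply: Zp_pow_inj; rewrite /= (padic_res_mod x (leqnSn k)); apply/eqP.
Qed.

(* The primality proof is an argument because the ring morphism structure below
   depends on it. *)
Definition padic_red (_ : prime p) x : 'F_p := (x 0%N : nat)%:R.
Local Notation red := (padic_red pr).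

Let redD x y : red (x + y) = red x + red y.
Proof.
by rewrite /padic_red -[(x + y) 0%N]/(x 0%N + y 0%N) val_ZpD Fp_mod1 natrD.
Qed.

Let red_zmod : zmod_morphism red.
Proof. by move=> x y; apply: (addIr (red y)); rewrite subrK -redD subrK. Qed.

Let red_monoid : monoid_morphism red.
Proof.
split; first by rewrite /padic_red -[(1 : padic_int p) 0%N]/(1%:R : 'Z_(p ^ 1)) val_Zp_pow
  Fp_mod1.
move=> x y.
by rewrite /padic_red -[(x * y) 0%N]/(x 0%N * y 0%N) val_ZpM Fp_mod1 natrM.
Qed.

HB.instance Definition _ := GRing.isZmodMorphism.Build _ _ red red_zmod.
HB.instance Definition _ := GRing.isMonoidMorphism.Build _ _ red red_monoid.

Lemma padic_red_val x : (red x : nat) = x 0%N.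
Proof. rewrite /padic_red val_Fp_nat // modn_small // -[X in (_ < X)%N]expn1.
exact: padic_res_lt. Qed.

Lemma padic_red_eq0 x : padic_dvd 1 x <-> red x = 0.
Proof.
rewrite padic_dvdP; split=> [e|e]; first by rewrite /padic_red e.
by apply: val_inj; rewrite /= -padic_red_val e.
Qed.

Lemma padic_red_ker x : red x = 0 -> exists y, x = p%:R * y.
Proof. by move=> /padic_red_eq0[y ->]; exists y; rewrite expr1. Qed.

Definition digit1 x : 'F_p := ((x 1%N : nat) %/ p)%:R.

Definition two_digits (a h : 'F_p) : padic_int p :=
  liftF (padic_int p) a + p%:R * liftF _ h.

Lemma two_digits_res (a h : 'F_p) : two_digits a h 1%N = ((a : nat) + p * (h : nat))%N%:R.
Proof.
by rewrite /two_digits /liftF -natrM -natrD padic_natr.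
Qed.

Lemma padic_digits x : exists y, x = two_digits (red x) (digit1 x) + p%:R ^+ 2 * y.
Proof.
suff /padic_dvdP[y yE] : (x - two_digits (red x) (digit1 x)) 1%N = 0.
  by exists y; rewrite -yE addrC subrK.
rewrite -[LHS]/(x 1%N - two_digits _ _ 1%N) two_digits_res padic_red_val.
rewrite (padic_res_mod x (leq0n 1)) expn1 /digit1 val_Fp_nat //.
rewrite [(_ %/ _ %% _)%N]modn_small; last first.
  by rewrite ltn_divLR // mulnn; exact: padic_res_lt.
by rewrite addnC mulnC -divn_eq natr_Zp subrr.
Qed.

(** * Haar measure of unions of classes modulo p^2 *)

Section Volume.
Variable n : nat.

Definition res2 (x : 'rV[padic_int p]_n) : 'rV['Z_(p ^ 2)]_n :=
  map_mx (fun y : padic_int p => y 1%N) x.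

Definition rep2 (ah : 'rV['F_p]_n * 'rV['F_p]_n) : 'rV[padic_int p]_n :=
  \row_i two_digits (ah.1 0 i) (ah.2 0 i).

Lemma res2D (x y : 'rV[padic_int p]_n) : res2 (x + y) = res2 x + res2 y.
Proof. by apply/rowP => i; rewrite !mxE. Qed.

Lemma res2_eq (x y : 'rV[padic_int p]_n) : res2 x = res2 y <-> exists z, x = y + p%:R ^+ 2 *: z.
Proof.
split=> [e|[z ->]]; last first.
  rewrite res2D -[RHS]addr0; congr (_ + _); apply/rowP => i; rewrite !mxE.
  by apply/padic_dvdP; eexists.
have H i : exists z, x 0 i - y 0 i = p%:R ^+ 2 * z.
  apply/(padic_dvdP 1); rewrite -[LHS]/(x 0 i 1%N - y 0 i 1%N).
  by have /rowP/(_ i) := e; rewrite !mxE => ->; rewrite subrr.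
have /choice[z zE] := H; exists (\row_i z i); apply/rowP => i.
by rewrite !mxE -zE addrC subrK.
Qed.

Lemma res2_rep2_bij : bijective (res2 \o rep2).
Proof.
apply: inj_card_bij => [[a h] [a' h'] /rowP e|]; last first.
  rewrite card_prod !card_mx !mul1n card_Fp // card_ord Zp_cast_pow.
  by rewrite -expnMn mulnn.
have lt (b : 'F_p) : ((b : nat) < p)%N by have := ltn_ord b; rewrite [X in (_ < X)%N ->
  _](Fp_cast pr).
have E i : ((a 0%R i : nat) + p * (h 0%R i : nat) = (a' 0%R i : nat) + p * (h' 0%R i : nat))%N.
  have := congr1 (@nat_of_ord _) (e i); rewrite !mxE !two_digits_res !val_Zp_pow.
  have H (b c : 'F_p) : (b + p * c < p ^ 2)%N.
    by have := lt b; have := lt c; rewrite expnS expn1; nia.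
  by rewrite !modn_small.
congr (_, _); apply/rowP => i; apply: val_inj => /=.
  have /(congr1 (modn^~ p)) := E i; rewrite ![(_ + p * _)%N]addnC ![(p * _)%N]mulnC.
  by rewrite !modnMDl !modn_small.
have /(congr1 (divn^~ p)) := E i; rewrite ![(_ + p * _)%N]addnC ![(p * _)%N]mulnC.
by rewrite !divnMDl // !divn_small // !addn0.
Qed.

Variables (R : realType) (lambda : probability (padic_space p n) R).
Hypothesis haar : is_haar lambda.
Local Open Scope classical_set_scope.

(** Unions of classes are indexed by lists so that additivity of the measure is a plain
    induction. *)
Definition pre_res2 (s : seq 'rV['Z_(p ^ 2)]_n) : set (padic_space p n) :=
  [set x : padic_space p n | res2 x \in s].

Lemma measurable_pre_res2 s : measurable (pre_res2 s).
Proof.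
apply: sub_sigma_algebra; rewrite openE => x xs.
exists (fun i j => [set y : padic_int p | y 1%N = x i j 1%N]).
  move=> i j; apply: open_nbhs_nbhs; split=> //.
  by move=> y ye; exists 1%N => z ze; exact: etrans ze ye.
move=> y ye; rewrite /pre_res2 /= (_ : res2 y = res2 x) //.
by apply/rowP => j; rewrite !mxE; exact: ye.
Qed.

Lemma haar_pre_res2_1 c : lambda (pre_res2 [:: c]) = lambda (pre_res2 [:: 0]).
Proof.
rewrite -(haar (map_mx (fun z : 'Z_(p ^ 2) => (z : nat)%:R) c) (measurable_pre_res2 [:: 0])).
set t := map_mx _ c; have rt : res2 t = c.
  by apply/rowP => i; rewrite !mxE padic_natr natr_Zp.
congr (lambda _); apply/seteqP; split=> x; rewrite /pre_res2 /=.
  rewrite mem_seq1 => /eqP e; exists (x - t); last by rewrite addrC subrK.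
  rewrite /= mem_seq1; apply/eqP/(addIr (res2 t)).
  by rewrite -res2D subrK add0r rt.
case=> y /=; rewrite mem_seq1 => /eqP e <-.
by rewrite mem_seq1 res2D e addr0 rt.
Qed.

Lemma haar_pre_res2 s : uniq s ->
  lambda (pre_res2 s) = ((size s)%:R%:E * lambda (pre_res2 [:: 0%R]))%E.
Proof.
elim: s => [_|c s IH /= /andP[cs us]].
  rewrite mul0e (_ : pre_res2 [::] = set0) ?measure0 //.
  by apply/seteqP; split.
have -> : pre_res2 (c :: s) = pre_res2 [:: c] `|` pre_res2 s.
  apply/seteqP; split=> x; rewrite /pre_res2 /= mem_seq1 in_cons.
      by case/orP => ->; [left|right].
    by case=> ->; rewrite ?orbT.
have disj : pre_res2 [:: c] `&` pre_res2 s = set0.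
  apply/seteqP; split=> // x [] /=; rewrite /pre_res2 /= mem_seq1 => /eqP -> cs'.
  by rewrite cs' in cs.
have -> : lambda (pre_res2 [:: c] `|` pre_res2 s) =
    (lambda (pre_res2 [:: c]) + lambda (pre_res2 s))%E.
  by apply: measureU disj; exact: measurable_pre_res2.
by rewrite IH // haar_pre_res2_1 -natr1 EFinD ge0_muleDl ?lee_fin // mul1e addeC.
Qed.

(** A set saturated modulo p^2 is a disjoint union of classes. Translation invariance gives the
    p^(2n) classes equal mass, and the total mass is 1. *)
Lemma vol_count (S : set {poly padic_int p}) (Q : pred ('rV['F_p]_n * 'rV['F_p]_n)) :
  (forall ah (y : 'rV[padic_int p]_n), S (monic_of_coefs (rep2 ah + p%:R ^+ 2 *: y)) <-> Q
    ah) ->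
  vol lambda S = #|Q|%:R / (p ^ (2 * n))%:R.
Proof.
move=> SQ; have inj := bij_inj res2_rep2_bij.
have [f fK Kf] := res2_rep2_bij.
set v := lambda (pre_res2 [:: 0]).
have card2 : #|{: 'rV['Z_(p ^ 2)]_n}| = (p ^ (2 * n))%N.
  by rewrite card_mx mul1n card_ord Zp_cast_pow expnM.
have vE : v = ((p ^ (2 * n))%:R^-1)%:E.
  have := haar_pre_res2 (enum_uniq {: 'rV['Z_(p ^ 2)]_n}).
  rewrite -cardE card2 (_ : pre_res2 _ = setT); last first.
    by apply/seteqP; split=> // x _; rewrite /pre_res2 /= mem_enum.
  rewrite probability_setT -/v.
  have n0 : (p ^ (2 * n))%:R != 0 :> R by rewrite pnatr_eq0 -lt0n.
  have vfin : v \is a fin_num by apply: fin_num_measure; exact: measurable_pre_res2.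
  rewrite -(fineK vfin) -EFinM => -[e]; congr (_%:E).
  by apply: (mulfI n0); rewrite -e divff.
rewrite /vol (_ : _ @^-1` S = pre_res2 [seq res2 (rep2 ah) | ah <- enum Q]).
  rewrite haar_pre_res2; last by rewrite map_inj_uniq ?enum_uniq.
  by rewrite -/v vE size_map -cardE -EFinM.
apply/seteqP; split=> x; rewrite /pre_res2 /=.
  have /res2_eq[z ->] : res2 x = res2 (rep2 (f (res2 x))) by rewrite -[RHS]/((_ \o _) _) Kf.
  move=> /SQ Qx; apply/mapP; exists (f (res2 x)); first by rewrite mem_enum.
  by apply/res2_eq; exists z.
case/mapP => ah; rewrite mem_enum => Qah /res2_eq[z ->].
exact/SQ.
Qed.

End Volume.

(** * The discriminant in terms of the first two digits *)

Section Discriminant.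
Variable n : nat.
Local Notation lft := (liftF (padic_int p)).

Definition digits_poly (ah : 'rV['F_p]_n * 'rV['F_p]_n) (y : 'rV[padic_int p]_n) :
  {poly padic_int p} := monic_of_coefs (rep2 ah + p%:R ^+ 2 *: y).

Lemma monic_of_coefs_monic (a : 'rV[padic_int p]_n) : monic_of_coefs a \is monic.
Proof.
by rewrite monicE lead_coefDl ?lead_coefXn // size_polyXn ltnS size_poly.
Qed.

Lemma size_monic_of_coefs (a : 'rV[padic_int p]_n) : size (monic_of_coefs a) = n.+1.
Proof. by rewrite size_polyDl size_polyXn // ltnS size_poly. Qed.

Lemma red_two_digits a h : red (two_digits a h) = a.
Proof. by rewrite rmorphD rmorphM (r_p pr) mul0r addr0 liftFK. Qed.

Lemma map_digits_poly ah (y : 'rV[padic_int p]_n) : map_poly red (digits_poly ah y) =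
  monicpoly ah.1.
Proof.
rewrite rmorphD /= map_polyXn /monicpoly; congr (_ + _).
rewrite map_rVpoly; congr rVpoly; apply/rowP => i; rewrite !mxE.
by rewrite rmorphD rmorphM rmorphXn (r_p pr) expr0n mul0r addr0; exact: red_two_digits.
Qed.

Lemma dvd_disc (f : {poly padic_int p}) : f \is monic -> size f = n.+1 ->
  padic_dvd 2 (discriminant f) <-> dvd_psq p (\det (modmul_mx n f f^`())).
Proof.
move=> mf sf; have [u [u' [uu' E]]] := resultant_modmul f^`() mf sf.
rewrite /discriminant E mulrA; set s := (-1) ^+ _.
have ss : s * s = 1 by rewrite -expr2 sqrr_sign.
split=> [[y yE]|[y ->]]; last by exists (s * u * y); rewrite mulrCA.
have c1 : u' * s * (s * u) = 1 by rewrite -mulrA (mulrA s) ss mul1r mulrC.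
by exists (u' * s * y); rewrite mulrCA -yE mulrA c1 mul1r.
Qed.

(* When [b] is a root of the reduction, this is the value at [b] divided by [p],
   for the canonical lifts of the polynomial and of [b]. *)
Definition root_digit (a : 'rV['F_p]_n) (b : 'F_p) : 'F_p :=
  digit1 (monic_of_coefs (rep2 (a, 0))).[lft b].

Lemma disc_sqfree ah (y : 'rV[padic_int p]_n) : sqfree (monicpoly ah.1) ->
  ~ padic_dvd 2 (discriminant (digits_poly ah y)).
Proof.
move=> sq; rewrite dvd_disc ?monic_of_coefs_monic ?size_monic_of_coefs //.
apply: (not_dvd_psq_det_sqfree pr (r := red)); rewrite ?monic_of_coefs_monic
  ?size_monic_of_coefs //.
by rewrite map_digits_poly.
Qed.

Lemma disc_double ah (y : 'rV[padic_int p]_n) w : w \is monic -> (2 < size w)%N ->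
  w %| monicpoly ah.1 -> w %| (monicpoly ah.1)^`() ->
  padic_dvd 2 (discriminant (digits_poly ah y)).
Proof.
move=> mw sw d d'; apply/dvd_disc; rewrite ?monic_of_coefs_monic ?size_monic_of_coefs //.
apply: (det_modmul_double pr padic_red_ker _ _ mw sw); rewrite ?monic_of_coefs_monic
  ?size_monic_of_coefs //.
  by rewrite map_digits_poly.
by rewrite -deriv_map map_digits_poly.
Qed.

Lemma disc_simple ah (y : 'rV[padic_int p]_n) b : odd p -> simple_double b (monicpoly ah.1) ->
  padic_dvd 2 (discriminant (digits_poly ah y)) <->
  root_digit ah.1 b + (rVpoly ah.2).[b] = 0.
Proof.
move=> op sb; rewrite dvd_disc ?monic_of_coefs_monic ?size_monic_of_coefs //.
have sb' : simple_double b (map_poly red (digits_poly ah y)) by rewrite map_digits_poly.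
rewrite (dvd_psq_det_simple pr padic_red_ker padic_mulp_inj op _ _ sb')
  ?monic_of_coefs_monic ?size_monic_of_coefs //.
set g := monic_of_coefs (rep2 (ah.1, 0)).
have rg : red g.[lft b] = 0.
  rewrite -horner_map liftFK.
  have := map_digits_poly (ah.1, 0) 0; rewrite /digits_poly scaler0 addr0 => -> /=.
  by have [/dvdpP[t ->] _ _] := sb; rewrite hornerM horner_exp hornerXsubC subrr expr0n mulr0.
have [z zE] := padic_digits g.[lft b].
pose hl : 'rV[padic_int p]_n := map_mx lft ah.2.
have -> : digits_poly ah y = g + p%:R *: rVpoly hl + p%:R ^+ 2 *: rVpoly y.
  rewrite /digits_poly /g /monic_of_coefs -!linearZ -!addrA -!linearD /=; congr (_ + rVpoly _).
  by apply/rowP => i; rewrite !mxE /two_digits [liftF _ 0](_ : _ = 0) // mulr0 addr0 addrA.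
rewrite 2!hornerD 2!hornerZ zE rg /two_digits -/(root_digit _ _).
rewrite [liftF _ 0](_ : _ = 0) // add0r.
set e := root_digit _ _.
have -> : p%:R * lft e + p%:R ^+ 2 * z + p%:R * (rVpoly hl).[lft b] + p%:R ^+ 2 * (rVpoly
  y).[lft b]
  = p%:R * (lft e + (rVpoly hl).[lft b]) + p%:R ^+ 2 * (z + (rVpoly y).[lft b]) by ring.
rewrite (dvd_psqD p).
have -> : e + (rVpoly ah.2).[b] = red (lft e + (rVpoly hl).[lft b]).
  rewrite rmorphD liftFK -horner_map liftFK map_rVpoly; congr (_ + (rVpoly _).[_]).
  by apply/rowP => i; rewrite !mxE liftFK.
split=> [[t tE]|/padic_red_ker[t ->]]; last by exists t; rewrite mulrA expr2.
apply/padic_red_eq0; exists t; rewrite expr1; apply/eqP; rewrite -subr_eq0;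
  apply/eqP/padic_mulp_inj.
by rewrite mulrBr tE expr2 mulrA subrr.
Qed.

Lemma U_set_digits_poly ah (y : 'rV[padic_int p]_n) : U_set n (digits_poly ah y) <->
  [forall i, ah.1 0 i != 0].
Proof.
have E (i : 'I_n) : padic_dvd 1 (digits_poly ah y)`_i <-> ah.1 0 i = 0.
  rewrite padic_red_eq0 -coef_map /= map_digits_poly coefD coefXn ltn_eqF // add0r.
  by rewrite coef_rVpoly_ord.
split=> [[_ _ H]|/forallP H].
  by apply/forallP => i; apply/eqP => /E; apply: H; rewrite ltnW.
split; rewrite ?monic_of_coefs_monic ?size_monic_of_coefs // => i.
rewrite leq_eqVlt => /predU1P[->|lt].
  have := monic_of_coefs_monic (rep2 ah + p%:R ^+ 2 *: y).
  rewrite monicE lead_coefE size_monic_of_coefs /= => /eqP; rewrite -/(digits_poly ah y) => ->.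
  by move/padic_red_eq0; rewrite rmorph1 => /eqP; rewrite oner_eq0.
by move/(E (Ordinal lt)); apply/eqP; exact: H.
Qed.

End Discriminant.

End Padic.

(** * Numerical estimates *)

Section Halves.
Implicit Types n d : nat.
Local Open Scope nat_scope.

Lemma half_leq n : n./2 <= n. Proof. lia. Qed.

Lemma half_leqS n : n./2.+1 <= n.+1. Proof. lia. Qed.

Lemma half_pred_leq n : n.-1./2 <= n. Proof. lia. Qed.

(** The truncation 2d + e <= n is an initial segment of the values of d, for e = 0, 2, 3 in turn. *)
Lemma leq_half0 n d : (2 * d + 0 <= n) = (d < n./2.+1). Proof. lia. Qed.

Lemma leq_half2 n d : (2 * d + 2 <= n) = (d < n./2). Proof. lia. Qed.

Lemma leq_half3 n d : (2 * d + 3 <= n) = (d < n.-1./2). Proof. lia. Qed.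

(** These bounds compare the truncation errors, which are powers of 1/q, with q^(-n/2). *)
Lemma half_exp0 n : n <= 2 * (2 * n./2).+1. Proof. lia. Qed.

Lemma half_exp2 n : n <= 2 * n./2.+1. Proof. lia. Qed.

Lemma half_exp3 n : n <= 2 * n.-1./2.+2. Proof. lia. Qed.

End Halves.

Section Numeric.
Variables (R : realFieldType).
Implicit Types (G del : nat -> R).

Lemma sum_nat_initial G n e K : (K <= n.+1)%N ->
  (forall d, (2 * d + e <= n)%N = (d < K)%N) ->
  \sum_(0 <= d < n.+1 | (2 * d + e <= n)%N) G d = \sum_(0 <= d < K) G d.
Proof.
move=> Kn H; under eq_bigl do rewrite H.
rewrite (big_cat_nat (n := K)) //= [X in _ + X]big_nat_cond [X in _ + X]big1 ?addr0.
  by rewrite big_nat_cond [RHS]big_nat_cond; apply: eq_bigl => d; case: (d < K)%N; rewrite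
    ?andbT ?andbF.
by move=> d /andP[/andP[Kd _]]; rewrite ltnNge Kd.
Qed.

Lemma sum_arith_prog_le G n e : (forall j, 0 <= G j) ->
  \sum_(0 <= d < n.+1 | (2 * d + e <= n)%N) G (2 * d + e)%N <= \sum_(0 <= j < n.+1) G j.
Proof.
move=> G0; rewrite !big_mkord.
have -> : \sum_(d < n.+1 | (2 * d + e <= n)%N) G (2 * d + e)%N =
    \sum_(d < n.+1) \sum_(j < n.+1 | (j : nat) == (2 * d + e)%N) G j.
  rewrite big_mkcond; apply: eq_bigr => d _; case: leqP => le.
    by rewrite (big_pred1 (Ordinal (le : (2 * d + e < n.+1)%N))).
  rewrite big_pred0 // => j; apply/eqP => e'; have := ltn_ord j.
  by rewrite e' ltnS leqNgt le.
rewrite (exchange_big_dep xpredT) //=; apply: ler_sum => j _.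
have [[d /eqP dj]|no] := pselect (exists d : 'I_n.+1, (j : nat) == (2 * d + e)%N).
  rewrite (big_pred1 d) // => d'; rewrite /= -val_eqE /= dj; apply/eqP/eqP => [|-> //].
  by lia.
by rewrite big_pred0 ?G0 // => d; apply/negP => H; apply: no; exists d.
Qed.

Variables (q : R) (q3 : 3 <= q).

Let q0 : 0 < q. Proof. exact: lt_le_trans q3. Qed.
Let qn0 : q != 0. Proof. by rewrite gt_eqF. Qed.
Let q1n0 : q + 1 != 0. Proof. by rewrite gt_eqF // addr_gt0. Qed.
Let qm1n0 : q - 1 != 0. Proof. by rewrite subr_eq0 gt_eqF // (lt_le_trans _ q3) // ltr1n. Qed.

(** The [t d] are the coefficients of (1 - qT)/(1 - T), whose value at T = q^(-2) is q/(q + 1); the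
    second term is the exact tail. *)
Lemma main_sum1 (t : nat -> R) D : t 0%N = 1 -> (forall d, (d < D)%N -> t d.+1 = 1 - q) ->
  \sum_(0 <= d < D.+1) t d * (q ^+ (2 * d))^-1 = q / (q + 1) + (q ^+ (2 * D))^-1 / (q + 1).
Proof.
move=> t0; elim: D => [|D IH] tS.
  by rewrite big_nat1 t0 muln0 expr0 invr1 mul1r -mulrDl divff.
rewrite big_nat_recr //= IH => [|d dD]; last by rewrite tS // ltnW.
rewrite tS // mulnSr exprD; field.
by rewrite q1n0 qn0 expf_neq0.
Qed.

(* The sum of [(1 - (q - 1) d) q^(-2d)] over all [d >= 0]. *)
Definition sum2_limit : R := q ^+ 3 / ((q - 1) * (q + 1) ^+ 2).

Lemma main_sum2 (t : nat -> R) K : (forall d, (d < K)%N -> t d = 1 - (q - 1) * d%:R) ->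
  \sum_(0 <= d < K) t d * (q ^+ (2 * d))^-1 =
  sum2_limit - (sum2_limit - K%:R * q ^+ 2 / (q + 1)) * (q ^+ (2 * K))^-1.
Proof.
elim: K => [|K IH] tE; first by rewrite big_geq // mul0r mul0r subr0 muln0 expr0 invr1
  mulr1 subrr.
rewrite big_nat_recr //= IH => [|d dK]; last by rewrite tE // ltnW.
rewrite tE // mulnSr exprD /sum2_limit -natr1; field.
by rewrite qm1n0 q1n0 qn0 expf_neq0.
Qed.

Lemma sum2_limit_bound : 0 <= sum2_limit <= 1.
Proof.
have q1 : 0 < q - 1 by rewrite subr_gt0 (lt_le_trans _ q3) // ltr1n.
apply/andP; split.
  apply: divr_ge0; first exact/exprn_ge0/ltW.
  apply: mulr_ge0; first exact: ltW.
  exact/exprn_ge0/ltW/addr_gt0.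
rewrite /sum2_limit ler_pdivrMr; last exact/mulr_gt0/exprn_gt0/addr_gt0.
rewrite mul1r.
by move: q3; nra.
Qed.

Lemma natr_le_expr K : K.+1%:R <= q ^+ K.
Proof.
elim: K => [|K IH]; first by rewrite expr0.
rewrite exprS -natr1; have : 1 <= q ^+ K by rewrite exprn_ege1 // (le_trans _ q3) // ler1n.
by move: IH q3; set x := q ^+ K => *; nra.
Qed.

(** The tail has order K q^(-2K); half of the decay absorbs the linear factor. *)
Lemma main_sum2_error K :
  `|(sum2_limit - K%:R * q ^+ 2 / (q + 1)) * (q ^+ (2 * K))^-1| <= 2 * (q ^+ K)^-1.
Proof.
have [c0 c1] := andP sum2_limit_bound.
have qK : 0 < q ^+ K by rewrite exprn_gt0.
have qK1 : 1 <= q ^+ K by rewrite exprn_ege1 // (le_trans _ q3) // ler1n.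
have B : K%:R * q ^+ 2 / (q + 1) <= q ^+ K.
  case: K {qK qK1} => [|K]; first by rewrite !mul0r expr0.
  rewrite ler_pdivrMr ?addr_gt0 //; have kx := natr_le_expr K.
  have x0 : 0 <= q ^+ K * q by rewrite mulr_ge0 ?exprn_ge0 // ltW.
  have : K.+1%:R * q ^+ 2 <= q ^+ K * q ^+ 2 by rewrite ler_wpM2r // exprn_ge0 // ltW.
  have -> : q ^+ K.+1 * (q + 1) = q ^+ K * q ^+ 2 + q ^+ K * q by rewrite exprS; ring.
  by lra.
have B0 : 0 <= K%:R * q ^+ 2 / (q + 1).
  by rewrite divr_ge0 ?mulr_ge0 ?exprn_ge0 ?addr_ge0 // ltW.
rewrite normrM [X in _ * X]ger0_norm; last by rewrite invr_ge0; exact/exprn_ge0/ltW.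
rewrite mul2n -addnn exprD invfM mulrA.
apply: ler_wpM2r; first by rewrite invr_ge0; exact/ltW.
rewrite ler_pdivrMr // ler_norml; apply/andP; split; lra.
Qed.

(* The root [s] of [q] absorbs the exponents d/2 and n/2. *)
Variables (s : R) (s2 : s ^+ 2 = q) (s1 : 1 <= s).

Let spow i j : (i <= j)%N -> s ^+ i <= s ^+ j.
Proof. by move=> ij; rewrite ler_weXn2l. Qed.

Let qpow k : q ^+ k = s ^+ (2 * k).
Proof. by rewrite -s2 exprM. Qed.

Let s0 : 0 < s. Proof. exact: lt_le_trans s1. Qed.

Let inv_spow i j : (i <= j)%N -> (s ^+ j)^-1 <= (s ^+ i)^-1.
Proof. by move=> ij; rewrite lef_pV2 ?posrE ?exprn_gt0 // spow. Qed.

Theorem density_estimate n T1 T2 T3 del (t v : nat -> R) : (2 <= n)%N ->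
  (forall j, 0 <= del j) ->
  t 0%N = 1 -> (forall d, (d < n)%N -> t d.+1 = 1 - q) ->
  (forall d, (d <= n)%N -> v d = 1 - (q - 1) * d%:R) ->
  `|T1 - \sum_(0 <= d < n.+1 | (2 * d + 0 <= n)%N) t d * (q ^+ (2 * d + 0))^-1|
    <= \sum_(0 <= d < n.+1 | (2 * d + 0 <= n)%N) q ^+ d * del (2 * d + 0)%N ->
  `|T2 - (q - 1) * \sum_(0 <= d < n.+1 | (2 * d + 2 <= n)%N) v d * (q ^+ (2 * d + 2))^-1|
    <= (q - 1) * \sum_(0 <= d < n.+1 | (2 * d + 2 <= n)%N) q ^+ d * del (2 * d + 2)%N ->
  `|T3 - (q - 1) * \sum_(0 <= d < n.+1 | (2 * d + 3 <= n)%N) v d * (q ^+ (2 * d + 3))^-1|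
    <= (q - 1) * \sum_(0 <= d < n.+1 | (2 * d + 3 <= n)%N) q ^+ d * del (2 * d + 3)%N ->
  `|T1 + (1 - q^-1) * (T2 - T3) - (1 - (3 * q - 1) / (q * (q + 1) ^+ 2))|
  <= 5 * (\sum_(0 <= d < n.+1) s ^+ d * del d + (s ^+ n)^-1).
Proof.
move=> n2 del0 t0 tS vE H1 H2 H3; set S := \sum_(0 <= d < n.+1) s ^+ d * del d.
have q1 : 0 < q - 1 by rewrite subr_gt0 (lt_le_trans _ q3) // ltr1n.
(* The factor c is 1 for e = 0 and q - 1, the number of nonzero b, for e = 2, 3. In the latter cases
   (q - 1) q^d <= q^(d+1), which the degree of the factor in X - b compensates. *)
have S_le e c (c0 : 0 <= c) : (forall d, c * q ^+ d <= s ^+ (2 * d + e)) ->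
    c * \sum_(0 <= d < n.+1 | (2 * d + e <= n)%N) q ^+ d * del (2 * d + e)%N <= S.
  move=> Hc; apply: le_trans (@sum_arith_prog_le (fun j => s ^+ j * del j) n e _); last first.
    by move=> j; rewrite mulr_ge0 // exprn_ge0 // ltW.
  by rewrite mulr_sumr; apply: ler_sum => d _; rewrite mulrA ler_wpM2r.
have {}H1 : `|T1 - \sum_(0 <= d < n.+1 | (2 * d + 0 <= n)%N) t d * (q ^+ (2 * d + 0))^-1| <= S.
  by apply: le_trans H1 _; rewrite -[X in X <= _]mul1r; apply: S_le => // d; rewrite mul1r
    qpow spow // leq_addr.
have {}H2 := le_trans H2 (S_le 2%N (q - 1) (ltW q1) _).
have {}H3 := le_trans H3 (S_le 3%N (q - 1) (ltW q1) _).
have c2 d : (q - 1) * q ^+ d <= s ^+ (2 * d + 2).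
  by rewrite exprD -qpow s2 mulrC ler_wpM2l ?exprn_ge0 ?ltW // gtrBl.
have {}H2 := H2 c2.
have {}H3 : `|T3 - (q - 1) * \sum_(0 <= d < n.+1 | (2 * d + 3 <= n)%N) v d * (q ^+ (2 * d +
  3))^-1| <= S.
  by apply: H3 => d; apply: le_trans (c2 d) _; rewrite spow // leq_add2l.
have M1 : \sum_(0 <= d < n.+1 | (2 * d + 0 <= n)%N) t d * (q ^+ (2 * d + 0))^-1 =
    q / (q + 1) + (q ^+ (2 * n./2))^-1 / (q + 1).
  rewrite (@sum_nat_initial _ _ _ n./2.+1); [|exact: half_leqS|by move=> d; exact: leq_half0].
  under eq_bigr do rewrite addn0.
  by apply: main_sum1 => // d dn; apply: tS; exact: leq_trans dn (half_leq n).
have M2 e K : (K <= n)%N -> (forall d, (2 * d + e <= n)%N = (d < K)%N) ->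
    \sum_(0 <= d < n.+1 | (2 * d + e <= n)%N) v d * (q ^+ (2 * d + e))^-1 =
    (sum2_limit - (sum2_limit - K%:R * q ^+ 2 / (q + 1)) * (q ^+ (2 * K))^-1) * (q ^+ e)^-1.
  move=> Kn HK; rewrite (@sum_nat_initial _ _ _ K) //; last by rewrite leqW.
  under eq_bigr do rewrite exprD invfM mulrA.
  by rewrite -mulr_suml main_sum2 // => d dK; apply: vE; rewrite (leq_trans (ltnW dK)).
rewrite M1 in H1; rewrite (M2 2%N n./2) in H2; [|exact: half_leq|by move=> d; exact: leq_half2].
rewrite (M2 3%N n.-1./2) in H3; [|exact: half_pred_leq|by move=> d; exact: leq_half3].
have := main_sum2_error n./2; have := main_sum2_error n.-1./2.
move: H2 H3.
set e2 := (sum2_limit - _) * (_ ^+ (2 * n./2))^-1; set e3 := (sum2_limit - _) * (_ ^+ (2 *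
  n.-1./2))^-1.
move=> H2 H3 E3 E2.
have F1 : 0 <= (q ^+ (2 * n./2))^-1 / (q + 1) <= (s ^+ n)^-1.
  apply/andP; split.
    apply: divr_ge0; last exact/ltW/addr_gt0.
    by rewrite invr_ge0; exact/exprn_ge0/ltW.
  apply: (@le_trans _ _ ((q ^+ (2 * n./2).+1)^-1)).
    rewrite exprSr invfM; apply: ler_wpM2l; first by rewrite invr_ge0; exact/exprn_ge0/ltW.
    by rewrite lef_pV2 ?posrE ?addr_gt0 // lerDl.
  rewrite qpow; apply: inv_spow; exact: half_exp0.
have mulCA2 (c a b : R) : c * (2 * a * b) = 2 * (a * (c * b)) by ring.
have F2 : (q - 1) * (2 * (q ^+ n./2)^-1 * (q ^+ 2)^-1) <= 2 * (s ^+ n)^-1.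
  apply: (@le_trans _ _ (2 * (q ^+ (n./2).+1)^-1)).
    rewrite [q ^+ n./2.+1]exprSr mulCA2 [X in _ <= 2 * X]invfM.
    rewrite ler_wpM2l //; apply: ler_wpM2l; first by rewrite invr_ge0; exact/exprn_ge0/ltW.
    by rewrite ler_pdivrMr ?exprn_gt0 // [q ^+ 2]expr2 mulKf // gerBl.
  rewrite ler_wpM2l // qpow; apply: inv_spow; exact: half_exp2.
have F3 : (q - 1) * (2 * (q ^+ n.-1./2)^-1 * (q ^+ 3)^-1) <= 2 * (s ^+ n)^-1.
  apply: (@le_trans _ _ (2 * (q ^+ (n.-1./2).+2)^-1)).
    rewrite [q ^+ n.-1./2.+2](_ : _ = q ^+ n.-1./2 * q ^+ 2); last by rewrite -exprD addn2.
    rewrite mulCA2 [X in _ <= 2 * X]invfM.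
    rewrite ler_wpM2l //; apply: ler_wpM2l; first by rewrite invr_ge0; exact/exprn_ge0/ltW.
    rewrite ler_pdivrMr ?exprn_gt0 //.
    by rewrite [q ^+ 3](exprSr q 2) mulKf ?expf_neq0 // gerBl.
  rewrite ler_wpM2l // qpow; apply: inv_spow; exact: half_exp3.
have G2 : `|(q - 1) * (e2 * (q ^+ 2)^-1)| <= 2 * (s ^+ n)^-1.
  apply: le_trans F2; rewrite 2!normrM (gtr0_norm q1) ler_pM2l // [`|_^-1|]ger0_norm; last
    first.
    by rewrite invr_ge0; exact/exprn_ge0/ltW.
  by apply: ler_wpM2r => //; rewrite invr_ge0; exact/exprn_ge0/ltW.
have G3 : `|(q - 1) * (e3 * (q ^+ 3)^-1)| <= 2 * (s ^+ n)^-1.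
  apply: le_trans F3; rewrite 2!normrM (gtr0_norm q1) ler_pM2l // [`|_^-1|]ger0_norm; last
    first.
    by rewrite invr_ge0; exact/exprn_ge0/ltW.
  by apply: ler_wpM2r => //; rewrite invr_ge0; exact/exprn_ge0/ltW.
(* The limits combine as S1 + (1 - 1/q) S2, where S2 is the difference between multiplicity at least
   2 and at least 3 at b. *)
have main : q / (q + 1) + (1 - q^-1) * ((q - 1) * (sum2_limit * (q ^+ 2)^-1) -
    (q - 1) * (sum2_limit * (q ^+ 3)^-1)) = 1 - (3 * q - 1) / (q * (q + 1) ^+ 2).
  by rewrite /sum2_limit; field; rewrite qm1n0 q1n0 qn0.
rewrite -main; move: H1 H2 H3 F1 G2 G3.
have dist (c a b d : R) : c * ((a - b) * d) = c * (a * d) - c * (b * d) by ring.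
rewrite !dist.
set f1 := _ / (q + 1); set g2 := (q - 1) * (e2 * _); set g3 := (q - 1) * (e3 * _).
set m2 := (q - 1) * (sum2_limit * _); set m3 := (q - 1) * (sum2_limit * _).
have : 0 < q^-1 < 1 by rewrite invr_gt0 q0 invf_lt1 // (lt_le_trans _ q3) // ltr1n.
have : 0 <= S by apply: sumr_ge0 => j _; rewrite mulr_ge0 // exprn_ge0 // ltW.
have : 0 <= (s ^+ n)^-1 by rewrite invr_ge0 exprn_ge0 // ltW.
set w := (s ^+ n)^-1; set i := q^-1; set m1 := q / (q + 1) => w0 S0 /andP[i0 i1].
clearbody f1 g2 g3 m2 m3 w i m1 S.
rewrite !ler_norml => /andP[a1 a2] /andP[b1 b2] /andP[c3 c4] /andP[d1 d2] /andP[x1 x2]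
  /andP[y1 y2].
(* [T2] and [T3] each cost S + 2w, and [T1] costs S + w: the total 3S + 5w explains the constant
   5. *)
have X : - (2 * S + 4 * w) <= T2 - T3 - (m2 - m3) <= 2 * S + 4 * w by apply/andP; split; lra.
have Y : - (2 * S + 4 * w) <= (1 - i) * (T2 - T3 - (m2 - m3)) <= 2 * S + 4 * w.
  by move: X; set x := T2 - T3 - (m2 - m3) => /andP[X1 X2]; apply/andP; split; nra.
have E : (1 - i) * (T2 - T3 - (m2 - m3)) = (1 - i) * (T2 - T3) - (1 - i) * (m2 - m3) by ring.
by move: Y; rewrite E => /andP[Y1 Y2]; apply/andP; split; lra.
Qed.

End Numeric.

(** * Densities over the prime field *)

Section Density.
Import mathcomp.boot.fintype mathcomp.boot.finset.
Variables (p : nat) (pr : prime p) (n : nat) (R : realType).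
Notation F := 'F_p.
Notation T := {poly_n.+1 F}.
Implicit Types (a h : 'rV[F]_n) (u : {poly F}).

Definition coefs_neq0 a := [forall i, a 0 i != 0].

Lemma card_coefs_neq0 : #|[pred a | coefs_neq0 a]| = (p.-1 ^ n)%N.
Proof.
pose g (f : {ffun 'I_n -> F}) : 'rV[F]_n := \row_i f i.
have ginj : injective g by move=> f f' /rowP e; apply/ffunP => i; have := e i; rewrite !mxE.
have -> : (p.-1 ^ n)%N = #|ffun_on_mem 'I_n (mem (predC1 (0 : F)))|.
  by rewrite card_ffun_on cardC1 card_Fp // card_ord.
rewrite -(card_image ginj); apply: eq_card => a; rewrite inE.
apply/forallP/imageP => [H|[f /ffun_onP H -> i]].
  exists [ffun i => a 0 i]; last by apply/rowP => i; rewrite !mxE ffunE.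
  by apply/ffun_onP => i; rewrite ffunE inE.
by rewrite mxE; have := H i; rewrite inE.
Qed.

Lemma natr_pred_p : (p.-1)%:R = p%:R - 1 :> R.
Proof. by rewrite -[in RHS](prednK (prime_gt0 pr)) -natr1 addrK. Qed.

Lemma natr_p_gt1 : 0 < p%:R - 1 :> R.
Proof. by rewrite -natr_pred_p ltr0n -subn1 subn_gt0 prime_gt1. Qed.

Definition dens u : R := #|[pred a | coefs_neq0 a & u %| monicpoly a]|%:R / (p%:R - 1) ^+ n.

(** [A_set] lists coefficients from the top degree down and [rVpoly] from the constant term up; the
    reversal preserves the condition that all are nonzero. *)
Lemma rVpoly_rev a : \sum_(i < n) a 0 i *: 'X^(n.-1 - i) =
  rVpoly (\row_i a 0 (rev_ord i)) :> {poly F}.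
Proof.
rewrite [RHS]poly_def (reindex_inj rev_ord_inj) /=; apply: eq_bigr => i _.
rewrite valK mxE; congr (_ *: 'X^_).
by have := ltn_ord i; lia.
Qed.

(** When alpha is congruent to -X^n modulo u, the congruence in [A_set] says that u divides the
    monic polynomial itself. *)
Lemma card_A_set u (al : {poly F}) : u %| 'X^n + al ->
  #|A_set n u al| = #|[pred a | coefs_neq0 a & u %| monicpoly a]|.
Proof.
move=> ual; pose g a : 'rV[F]_n := \row_i a 0 (rev_ord i).
have gK : involutive g by move=> a; apply/rowP => i; rewrite !mxE rev_ordK.
have gnz a : coefs_neq0 (g a) = coefs_neq0 a.
  apply/forallP/forallP => H i; last by rewrite mxE.
  by have := H (rev_ord i); rewrite mxE rev_ordK.
rewrite -(card_image (inv_inj gK)); apply: eq_card => a.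
rewrite -[a]gK mem_image ?inE; last exact: inv_inj.
rewrite gnz -/(coefs_neq0 _) rVpoly_rev; congr (_ && _).
rewrite /monicpoly -/(g _) -[in RHS](dvdp_subl _ ual).
by rewrite opprD addrACA subrr add0r.
Qed.

Lemma delta_ge0 d : 0 <= delta R n p d.
Proof. exact: bigmax_ge_id. Qed.

Lemma dens_delta u d : u \is monic -> size u = d.+1 -> ~~ ('X %| u) ->
  `|dens u - (p%:R ^+ d)^-1| <= delta R n p d.
Proof.
move=> mu su Xu; pose al : {poly F} := - ('X^n %% u).
have sal : (size al <= d)%N.
  by rewrite size_polyN -ltnS -su ltn_modp monic_neq0.
have ual : u %| 'X^n + al.
  by rewrite {1}(divp_eq 'X^n u) addrK dvdp_mull.
rewrite /dens -(card_A_set ual) /delta.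
pose u' : {poly_d.+1 F} := npolyp d.+1 u; have u'E : u' = u :> {poly F} by rewrite npolypK ?su.
pose al' : {poly_d F} := npolyp d al; have al'E : al' = al :> {poly F} by rewrite npolypK.
rewrite -[X in A_set n X al]u'E -al'E.
apply: le_trans (le_bigmax _ (fun al0 : {poly_d F} =>
  `|#|A_set n u' al0|%:R / (p%:R - 1) ^+ n - (p%:R ^+ d)^-1|) al') _.
apply: (le_bigmax_cond _ (fun u0 : {poly_d.+1 F} => \big[Num.max/0]_(al0 : {poly_d F})
  `|#|A_set n u0 al0|%:R / (p%:R - 1) ^+ n - (p%:R ^+ d)^-1|)).
by rewrite u'E mu su eqxx Xu.
Qed.

Lemma dens_big u : (n.+1 < size u)%N -> dens u = 0.
Proof.
move=> su; rewrite /dens eq_card0 ?mul0r // => a; rewrite inE.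
apply/negP => /andP[_ /dvdp_leq]; rewrite monic_neq0 ?monicpoly_monic // size_monicpoly =>
  /(_ isT).
by rewrite leqNgt su.
Qed.

(** Coprimality merges divisibility by [g] and by the square of [prodI I] into divisibility by their
    product, so that a single density is involved. *)
Lemma sieve_sum (E : {set T}) (g : {poly F}) :
  (forall I : {set T}, I \subset monic_irrs F n :\: E -> coprimep g (prodI I)) ->
  (\sum_(a | coefs_neq0 a) (g %| monicpoly a)%R%:R *
     [forall t in monic_irrs F n :\: E, ~~ ((t : {poly F}) ^+ 2 %| monicpoly a)]%R%:R) /
       (p%:R - 1) ^+ n
  = \sum_(I : {set T} | I \subset monic_irrs F n :\: E) (-1) ^+ #|I| * dens (g * prodI I ^+
    2) :> R.
Proof.
move=> cop; under eq_bigr do rewrite -sum_sign_dvd mulr_sumr.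
rewrite exchange_big /= mulr_suml; apply: eq_bigr => I sI.
rewrite /dens [in RHS]mulrA; congr (_ / _).
have -> : #|[pred a | coefs_neq0 a & g * prodI I ^+ 2 %| monicpoly a]|%:R =
    \sum_(a | coefs_neq0 a && (g * prodI I ^+ 2 %| monicpoly a)) 1 :> R.
  by rewrite -sum1_card natr_sum.
rewrite mulr_sumr.
rewrite [RHS]big_mkcondr; apply: eq_bigr => a _.
rewrite (Gauss_dvdp _ (coprimep_expr 2 (cop I sI))).
by case: (g %| _); case: (_ %| monicpoly a); rewrite /= ?mul1r ?mul0r ?mulr0.
Qed.

Hypothesis n0 : (0 < n)%N.

Lemma coefs_neq0_XNdvd a : coefs_neq0 a -> ~~ ('X %| monicpoly a).
Proof.
move=> /forallP/(_ (Ordinal n0)); apply: contra.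
have := dvdp_XsubCl (monicpoly a) 0; rewrite polyC0 subr0 => ->.
by rewrite rootE horner_coef0 coefD coefXn ltn_eqF // add0r (coef_rVpoly_ord _ (Ordinal n0)).
Qed.

Definition npX : T := npolyp n.+1 'X.
Definition npXsubC (b : F) : T := npolyp n.+1 ('X - b%:P).

Lemma npXE : npX = 'X :> {poly F}.
Proof. by rewrite npolypK ?size_polyX. Qed.

Lemma npXsubCE b : npXsubC b = 'X - b%:P :> {poly F}.
Proof. by rewrite npolypK ?size_XsubC. Qed.

Lemma npXsubC_irr b : npXsubC b \in monic_irrs F n.
Proof. by apply/monic_irrsP; rewrite npXsubCE monicXsubC; split=> //; exact: irredp_XsubC. Qed.

Lemma npX_XsubC0 : npX = npXsubC 0.
Proof. by apply: val_inj; rewrite /= -/npX -/(npXsubC 0) npXE npXsubCE polyC0 subr0. Qed.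

(** An irreducible whose square divides a polynomial of degree n has degree at most n, so testing
    the members of [monic_irrs] is enough. *)
Lemma sieve_forallP (E : {set T}) a :
  reflect (forall q : {poly F}, q \is monic -> irreducible_poly q ->
      (forall t, t \in E -> q != (t : {poly F})) -> ~~ (q ^+ 2 %| monicpoly a))
    [forall t in monic_irrs F n :\: E, ~~ ((t : {poly F}) ^+ 2 %| monicpoly a)].
Proof.
apply: (iffP forall_inP) => [H q mq iq qE|H t]; last first.
  rewrite in_setD => /andP[tE /monic_irrsP[mt it]]; apply: H => // t' t'E.
  by apply: contraNneq tE => /val_inj ->.
apply/negP => q2; have sq : (size q <= n.+1)%N.
  rewrite -(size_monicpoly a) (leq_trans _ (dvdp_leq _ q2)) ?monic_neq0 ?monicpoly_monic //.
  by apply: dvdp_leq; [rewrite monic_neq0 ?monic_exp | exact: dvdp_exp].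
have := H (npolyp n.+1 q); rewrite npolypK // q2 => /(_ _)/negP; apply=> //.
rewrite in_setD; apply/andP; split; last by apply/monic_irrsP; rewrite npolypK.
by apply/negP => /qE; rewrite npolypK // eqxx.
Qed.

Lemma sqfree_sieve a : coefs_neq0 a ->
  `[< sqfree (monicpoly a) >] =
  [forall t in monic_irrs F n :\: [set npX], ~~ ((t : {poly F}) ^+ 2 %| monicpoly a)].
Proof.
move=> nza; apply/asboolP/sieve_forallP => [sq q mq iq _|H q mq iq]; first exact: sq.
have [qX|nqX] := eqVneq q 'X.
  rewrite qX; apply: contra (coefs_neq0_XNdvd nza); apply: dvdp_trans.
  by rewrite expr2 dvdp_mulr.
by apply: H => // t; rewrite inE => /eqP ->; rewrite npXE.
Qed.

Lemma simple_double_inj b b' a : simple_double b (monicpoly a) ->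
  simple_double b' (monicpoly a) -> b = b'.
Proof.
move=> [d _ _] [_ _ H]; apply/eqP; apply: contraTT d => ne.
apply: H; rewrite ?monicXsubC //; first exact: irredp_XsubC.
by apply: contra ne => /eqP/addrI/oppr_inj/polyC_inj ->.
Qed.

(** Multiplicity exactly 2 is the difference of the indicators for the square and the cube, as the
    cube forces the square. X may join the excluded set since it never divides. *)
Lemma simple_sieve a b : coefs_neq0 a -> b != 0 ->
  `[< simple_double b (monicpoly a) >]%:R =
  ((('X - b%:P) ^+ 2 %| monicpoly a)%R%:R - (('X - b%:P) ^+ 3 %| monicpoly a)%R%:R) *
  [forall t in monic_irrs F n :\: [set npXsubC b; npX], ~~ ((t : {poly F}) ^+ 2 %|
    monicpoly a)]%R%:R :> R.
Proof.
move=> nza b0.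
have d32 : ('X - b%:P) ^+ 3 %| monicpoly a -> ('X - b%:P) ^+ 2 %| monicpoly a.
  by apply: dvdp_trans; rewrite dvdp_exp2l.
have E : [forall t in monic_irrs F n :\: [set npXsubC b; npX], ~~ ((t : {poly F}) ^+ 2 %|
  monicpoly a)] =
    `[< forall q : {poly F}, q \is monic -> irreducible_poly q -> q != 'X - b%:P ->
         ~~ (q ^+ 2 %| monicpoly a) >].
  apply/sieve_forallP/asboolP => H q mq iq qn.
    have [qX|nqX] := eqVneq q 'X.
      rewrite qX; apply: contra (coefs_neq0_XNdvd nza); apply: dvdp_trans.
      by rewrite expr2 dvdp_mulr.
    by apply: H => // t; rewrite !inE => /orP[]/eqP->; rewrite ?npXE ?npXsubCE.
  apply: H => //; have := qn (npXsubC b); rewrite npXsubCE; apply.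
  by rewrite !inE eqxx.
rewrite E; have [H|nH] := pselect (simple_double b (monicpoly a)).
  rewrite (asboolT H); have [-> /negPf-> H'] := H.
  by rewrite (asboolT H') subr0 mulr1.
rewrite (asboolF nH); case: asboolP => H; last by rewrite mulr0.
rewrite mulr1; case: (boolP (_ ^+ 3 %| _)) => [/[dup] d3 /d32 ->|d3]; first by rewrite subrr.
case: (boolP (_ ^+ 2 %| _)) => d2; last by rewrite subrr.
by exfalso; apply: nH; split.
Qed.

(** The double root is unique, and it is nonzero because X does not divide the polynomial. *)
Lemma exists_simple_sum a : coefs_neq0 a ->
  `[< exists b, simple_double b (monicpoly a) >]%:R =
  \sum_(b : F | b != 0) `[< simple_double b (monicpoly a) >]%:R :> R.
Proof.
move=> nza; have [[b sb]|no] := pselect (exists b, simple_double b (monicpoly a)); last first.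
  rewrite asboolF // big1 // => b _; rewrite asboolF // => sb.
  by apply: no; exists b.
have b0 : b != 0.
  apply/eqP => be; move: sb; rewrite be => -[d _ _]; have := coefs_neq0_XNdvd nza.
  move: d; rewrite polyC0 subr0 => d /negP; apply; apply: dvdp_trans d.
  by rewrite expr2 dvdp_mulr.
rewrite asboolT; last by exists b.
rewrite (bigD1 b) //= asboolT // big1 ?addr0 // => b' /andP[_ nb].
by rewrite asboolF // => sb'; move: nb; rewrite (simple_double_inj sb' sb) eqxx.
Qed.

Definition sqfree_prop : R := (\sum_(a | coefs_neq0 a) `[< sqfree (monicpoly a) >]%:R) /
  (p%:R - 1) ^+ n.

Definition simple_prop : R :=
  (\sum_(a | coefs_neq0 a) `[< exists b, simple_double b (monicpoly a) >]%:R) / (p%:R - 1) ^+ n.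

(* By inclusion-exclusion, the proportion of the polynomials divisible by
   [(X - b)^k] for some nonzero [b], with no other irreducible square factor. *)
Definition mult_prop k : R := \sum_(b : F | b != 0)
  \sum_(I : {set T} | I \subset monic_irrs F n :\: [set npXsubC b; npX])
     (-1) ^+ #|I| * dens (('X - b%:P) ^+ k * prodI I ^+ 2).

Lemma sqfree_propE : sqfree_prop =
  \sum_(I : {set T} | I \subset monic_irrs F n :\: [set npX]) (-1) ^+ #|I| * dens (1 *
    prodI I ^+ 2).
Proof.
rewrite -sieve_sum => [|I _]; last exact: coprime1p.
congr (_ / _); apply: eq_bigr => a nza.
by rewrite sqfree_sieve // dvd1p mul1r.
Qed.

Lemma simple_propE : simple_prop = mult_prop 2 - mult_prop 3.
Proof.
have cop b k (I : {set T}) : I \subset monic_irrs F n :\: [set npXsubC b; npX] ->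
    coprimep (('X - b%:P) ^+ k) (prodI I).
  move=> sI; apply: coprimep_expl; rewrite irreducible_poly_coprime; last exact: irredp_XsubC.
  rewrite -npXsubCE irr_dvd_prodI ?npXsubC_irr //; last by rewrite (subset_trans sI) ?subsetDl.
  by apply/negP => /(subsetP sI); rewrite !inE eqxx.
rewrite /simple_prop /mult_prop -sumrB.
under [RHS]eq_bigr => b _ do rewrite -(sieve_sum (@cop b 2%N)) -(sieve_sum (@cop b 3%N))
  -mulrBl -sumrB.
rewrite -mulr_suml exchange_big /=; congr (_ / _); apply: eq_bigr => a nza.
rewrite exists_simple_sum //; apply: eq_bigr => b b0.
by rewrite simple_sieve // mulrBl.
Qed.

Lemma sqfree_simple_estimate : (2 <= n)%N -> odd p ->
  `|sqfree_prop + (1 - p%:R^-1) * simple_prop - (1 - (3 * p%:R - 1) / (p%:R * (p%:R + 1) ^+ 2))|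
  <= 5 * (\sum_(0 <= d < n.+1) p%:R `^ (d%:R / 2) * delta R n p d + 1 / (p%:R `^ (n%:R / 2))).
Proof.
move=> n2 op; set s : R := p%:R `^ (2^-1).
have s2 : s ^+ 2 = p%:R.
  by rewrite -powR_mulrn ?powR_ge0 // -powRrM mulVf ?powRr1 // pnatr_eq0.
have p3 : (3 <= p)%N by have := prime_gt1 pr; case: (p) op => [|[|[|]]].
have q3 : 3 <= p%:R :> R by rewrite ler_nat.
have s1 : 1 <= s.
  rewrite -(@ler_pXn2r _ 2) ?nnegrE ?powR_ge0 // s2 expr1n ler1n; exact: ltnW (ltnW p3).
have sE d : p%:R `^ (d%:R / 2) = s ^+ d by rewrite mulrC powRrM powR_mulrn // powR_ge0.
under eq_bigr do rewrite sE; rewrite sE mul1r simple_propE.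
have tXi := npXsubC_irr 0; rewrite -npX_XsubC0 in tXi.
have tXs : size (npX : {poly F}) = 2%N by rewrite npXE size_polyX.
have close := fun u d mu su (_ : (d <= n)%N) Xu => @dens_delta u d mu su Xu.
have cF : #|F| = p by rewrite card_Fp.
have Xb (b : F) k : b != 0 -> ~~ ('X %| ('X - b%:P) ^+ k).
  move=> b0; have := dvdp_XsubCl (('X - b%:P) ^+ k) (0 : F); rewrite polyC0 subr0 => ->.
  by rewrite rootE horner_exp hornerXsubC sub0r expf_neq0 // oppr_eq0.
(* All p - 1 nonzero values of b have the same main term and the same error bound. *)
have Hk k : `|mult_prop k - (p%:R - 1) * \sum_(0 <= d < n.+1 | (2 * d + k <= n)%N)
      (1 - (p%:R - 1) * d%:R) * (p%:R ^+ (2 * d + k))^-1|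
    <= (p%:R - 1) * \sum_(0 <= d < n.+1 | (2 * d + k <= n)%N) p%:R ^+ d * delta R n p (2 *
      d + k)%N.
  have card b0 : \sum_(b : F | b != 0) b0 = (p%:R - 1) * b0 :> R.
    rewrite sumr_const -[_ *+ _]mulr_natl -natr_pred_p; congr (_%:R * _).
    by transitivity #|F|.-1; [exact: cardC1 | rewrite cF].
  rewrite -!card /mult_prop -sumrB (le_trans (ler_norm_sum _ _ _)) // ler_sum // => b b0.
  have := @sieve_estimate F n R [set npXsubC b; npX] (('X - b%:P) ^+ k) k dens (delta R n p).
  rewrite cF !inE eqxx orbT monic_exp ?monicXsubC // size_exp_XsubC Xb //.
  move=> /(_ isT n0 isT erefl isT close dens_big); apply: le_trans.
  rewrite le_eqVlt; apply/orP; left; apply/eqP; congr (`| _ - _|).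
  apply: eq_bigr => d dn.
  have dn' : (d <= n)%N by rewrite (leq_trans _ dn) // (leq_trans _ (leq_addr _ _)) //
    leq_pmull.
  rewrite (signed_count2 _ tXi tXs (npXsubC_irr b)) ?cF // ?npXsubCE ?size_XsubC //.
  by rewrite npX_XsubC0; apply: contra b0 => /eqP/(congr1 val) /=; rewrite -/(npXsubC b)
    -/(npXsubC 0) !npXsubCE => /addrI/oppr_inj/polyC_inj ->.
apply: (@density_estimate R p%:R q3 s s2 s1 n sqfree_prop _ _ (delta R n p)
  (fun d => signed_count R [set npX] d) (fun d => 1 - (p%:R - 1) * d%:R)) => //.
- exact: delta_ge0.
- exact: signed_count0.
- by move=> d dn; rewrite signed_count1 // cF.
- rewrite sqfree_propE; have := @sieve_estimate F n R [set npX] 1 0%N dens (delta R n p).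
  rewrite cF inE eqxx monic1 size_poly1 dvdp1 size_polyX.
  exact: (fun H => H isT n0 isT erefl isT close dens_big).
Qed.

End Density.

(** * From counts of digits to [P_sqf] *)

Section Proportion.
Import mathcomp.boot.fintype.
Variables (p : nat) (pr : prime p) (n : nat).
Notation F := 'F_p.
Implicit Types (a h : 'rV[F]_n).

Lemma card_coefs_neq0_pairs (Q : pred ('rV[F]_n * 'rV[F]_n)) :
  #|[pred ah | coefs_neq0 ah.1 && Q ah]| = (\sum_(a | coefs_neq0 a) #|[pred h | Q (a, h)]|)%N.
Proof.
rewrite -sum1_card; under [RHS]eq_bigr do rewrite -sum1_card.
by rewrite pair_big_dep /=; apply: eq_bigl => -[a h].
Qed.

(** Adding constants permutes the fibres of evaluation at b, so the p fibres have equal size. *)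
Lemma card_horner_eq (b c : F) : (0 < n)%N ->
  #|[pred h : 'rV[F]_n | c + (rVpoly h).[b] == 0]| = (p ^ n.-1)%N.
Proof.
move=> n0; pose K t := #|[pred h : 'rV[F]_n | (rVpoly h).[b] == t]|.
pose e : 'rV[F]_n := delta_mx 0 (Ordinal n0).
have he : (rVpoly e).[b] = 1 by rewrite rVpoly_delta /= hornerXn expr0.
have Kt t : K t = K 0.
  pose g h := h - t *: e; have ginj : injective g := @addIr _ _.
  have gK h : g (h + t *: e) = h := addrK _ _.
  rewrite /K -(card_image ginj); apply: eq_card => h.
  rewrite -[in LHS](gK h) (mem_image ginj) !inE linearD linearZ hornerD hornerZ he.
  by rewrite mulr1 -subr_eq0 addrK.
have sumK : (\sum_t K t = p ^ n)%N.
  have <- : #|{: 'rV[F]_n}| = (p ^ n)%N by rewrite card_mx mul1n card_Fp.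
  rewrite -sum1_card (partition_big (fun h : 'rV[F]_n => (rVpoly h).[b]) xpredT) //=.
  by apply: eq_bigr => t _; rewrite /K -sum1_card; apply: eq_bigl => h; rewrite inE.
have -> : #|[pred h : 'rV[F]_n | c + (rVpoly h).[b] == 0]| = K (- c).
  by apply: eq_card => h; rewrite !inE addrC addr_eq0.
have : (p * K 0%R = p * p ^ n.-1)%N.
  rewrite -expnS prednK // -sumK; under eq_bigr do rewrite Kt.
  by rewrite sum_nat_const card_Fp.
by move/eqP; rewrite eqn_pmul2l ?prime_gt0 // Kt => /eqP.
Qed.

Variables (R : realType) (lambda : probability (padic_space p n) R).
Hypothesis haar : is_haar lambda.

(** Both volumes have denominator p^(2n), which cancels; (p - 1)^n p^n pairs of digit vectors
    describe [U_set]. *)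
Lemma P_sqf_count (Q : pred ('rV[F]_n * 'rV[F]_n)) :
  (forall ah (y : 'rV[padic_int p]_n), coefs_neq0 ah.1 ->
     ~ padic_dvd 2 (discriminant (digits_poly ah y)) <-> Q ah) ->
  P_sqf lambda = (\sum_(a | coefs_neq0 a) #|[pred h | Q (a, h)]|%:R) / (p%:R * (p%:R - 1)) ^+ n.
Proof.
move=> HQ; rewrite /P_sqf.
rewrite (vol_count pr haar (Q := [pred ah | coefs_neq0 ah.1 && Q ah])); last first.
  move=> ah y; rewrite -/(digits_poly ah y); split=> [[/(U_set_digits_poly pr)
    nza]|/andP[nza Qa]].
    by move=> /(HQ _ y nza) Qa; apply/andP.
  by split; [apply/(U_set_digits_poly pr) | apply/(HQ _ y nza)].
rewrite (vol_count pr haar (Q := [pred ah | coefs_neq0 ah.1])); last first.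
  by move=> ah y; exact: (U_set_digits_poly pr).
have -> : #|[pred ah : 'rV[F]_n * 'rV[F]_n | coefs_neq0 ah.1]| = (p.-1 ^ n * p ^ n)%N.
  rewrite (eq_card (B := [pred ah | coefs_neq0 ah.1 && predT ah])); last by move=> ah;
    rewrite !inE andbT.
  rewrite card_coefs_neq0_pairs -(card_coefs_neq0 pr n) -sum_nat_const; apply: eq_bigr => a _.
  by rewrite (eq_card (B := {: 'rV[F]_n})) ?card_mx ?mul1n ?card_Fp.
rewrite card_coefs_neq0_pairs natr_sum natrM !natrX (natr_pred_p pr).
have q0 : p%:R != 0 :> R by rewrite pnatr_eq0 -lt0n prime_gt0.
have q1 : p%:R - 1 != 0 :> R by rewrite gt_eqF // natr_p_gt1.
rewrite exprMn; field.
by rewrite !expf_neq0.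
Qed.

Lemma P_sqf_odd : odd p -> (2 <= n)%N ->
  P_sqf lambda = sqfree_prop p n R + (1 - p%:R^-1) * simple_prop p n R.
Proof.
move=> op n2; have n0 : (0 < n)%N by exact: ltnW.
have mne (a : 'rV[F]_n) : monicpoly a != 0 by rewrite monic_neq0 ?monicpoly_monic.
(* In each of the three shapes, divisibility by p^2 is decided by the two digits, so y = 0
   represents the class. *)
have inv ah (y : 'rV[padic_int p]_n) : ~ padic_dvd 2 (discriminant (digits_poly ah y)) <->
    `[< ~ padic_dvd 2 (discriminant (digits_poly ah 0)) >].
  rewrite asboolE; case: (sqfree_simple_or_double (mne ah.1)) => [sq|[b sb]|[w [mw sw w1 w2]]].
  - by split=> _; exact: (disc_sqfree pr).
  - by rewrite !(disc_simple pr _ op sb).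
  - by split=> H; exfalso; apply: H; exact: (disc_double pr _ mw sw).
rewrite (P_sqf_count (fun ah y _ => inv ah y)).
rewrite /sqfree_prop /simple_prop mulrA mulr_sumr -mulrDl -big_split /= exprMn.
have q0 : p%:R != 0 :> R by rewrite pnatr_eq0 -lt0n prime_gt0.
rewrite invfM mulrA; congr (_ * _); rewrite mulr_suml; apply: eq_bigr => a _.
have qn : p%:R ^+ n != 0 :> R by rewrite expf_neq0.
case: (sqfree_simple_or_double (mne a)) => [sq|[b sb]|[w [mw sw w1 w2]]].
- rewrite (asboolT sq) asboolF; last first.
    move=> [b [d _ _]]; have := sq _ (monicXsubC b) (irredp_XsubC b).
    by rewrite d.
  rewrite mulr0 addr0 (eq_card (B := {: 'rV[F]_n})); last first.
    by move=> h; rewrite !inE; apply/asboolT; exact: (disc_sqfree pr).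
  by rewrite card_mx mul1n card_Fp // natrX divff.
- rewrite asboolF; last first.
    by move=> sq; have [d _ _] := sb; have := sq _ (monicXsubC b) (irredp_XsubC b); rewrite d.
  rewrite asboolT; last by exists b.
  rewrite add0r mulr1.
  rewrite (eq_card (B := predC [pred h : 'rV[F]_n | root_digit a b + (rVpoly h).[b] ==
    0])); last first.
    move=> h; have ds := disc_simple pr 0 (ah := (a, h)) op sb.
    rewrite !inE; apply/asboolP/negP => [H /eqP E|H /ds E]; first by apply/H/ds.
    by apply: H; apply/eqP.
  (* The second digits to discard form one fibre of evaluation at b, p^(n-1) vectors out of p^n:
     hence the factor 1 - 1/p. *)
  have := cardC [pred h : 'rV[F]_n | root_digit a b + (rVpoly h).[b] == 0].
  rewrite card_horner_eq // card_mx mul1n card_Fp // => E.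
  have {E} : (p%:R ^+ n.-1 + #|predC [pred h : 'rV[F]_n | root_digit a b + (rVpoly h).[b]
    == 0]|%:R = p%:R ^+ n :> R).
    by rewrite -!natrX -natrD E.
  move=> /(canRL (addKr _)) ->; rewrite addrC mulrBl divff //; congr (_ - _).
  by rewrite -[in X in _ / X](prednK n0) exprS invfM mulrCA divff ?mulr1 // expf_neq0.
- rewrite asboolF; last first.
    move=> sq; have := @disc_sqfree _ pr _ (a, 0) 0 sq; apply.
    exact: (disc_double pr _ mw sw).
  (* Exclusivity is deduced from the discriminant: a simple double root would leave some second
     digits for which p^2 does not divide it, against the existence of [w]. *)
  rewrite asboolF; last first.
    move=> [b sb]; have [g [fE ga sg]] := simple_doubleE sb.
    suff : exists h : 'rV[F]_n, root_digit a b + (rVpoly h).[b] != 0.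
      move=> [h /eqP H]; apply: H; apply/(disc_simple pr 0 (ah := (a, h)) op sb).
      exact: (disc_double pr _ mw sw).
    have c1 := card_horner_eq b (root_digit a b) n0.
    apply: contrapT => H; have : #|{: 'rV[F]_n}| = (p ^ n.-1)%N.
      rewrite -c1; apply: eq_card => h; rewrite !inE; apply/esym; apply: contrapT => /negP nh.
      by apply: H; exists h.
    rewrite card_mx mul1n card_Fp // => /eqP; rewrite eqn_exp2l ?prime_gt1 //.
    by rewrite -{1}(prednK n0) gtn_eqF.
  rewrite mulr0 addr0 eq_card0 ?mul0r // => h; rewrite !inE.
  by apply/asboolPn => H; apply: H; exact: (disc_double pr _ mw sw).
Qed.

End Proportion.

(** * The prime 2 *)

Section Two.
Variable n : nat.
Notation F := 'F_2.

Lemma addrr_F2 (x : {poly F}) : x + x = 0.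
Proof. by apply: addrr_pchar2; rewrite pchar_poly pchar_Fp. Qed.

Lemma mulrn2_F2 (x : {poly F}) m : x *+ (2 * m) = 0.
Proof. by rewrite mulrnA mulr2n addrr_F2 mul0rn. Qed.

Lemma monicpoly_F2 (a : 'rV[F]_n) : coefs_neq0 a ->
  ('X - 1) * monicpoly a = 'X^(n.+1) - 1.
Proof.
move=> /forallP nza; rewrite subrX1; congr (_ * _).
rewrite big_ord_recr /= addrC /monicpoly; congr (_ + _).
rewrite /rVpoly poly_def; apply: eq_bigr => i _; rewrite valK /=.
have -> : a 0 i = 1; last by rewrite scale1r.
by have := nza i; case: (a 0 i) => [[|[|m]] lt] // _; apply: val_inj.
Qed.

(** For n even, X^(n+1) - 1 has derivative X^n. A repeated factor would divide both, hence also
    1. *)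
Lemma monicpoly_F2_even (a : 'rV[F]_n) : (2 %| n)%N -> coefs_neq0 a -> sqfree (monicpoly a).
Proof.
move=> /dvdnP[m nE] nza q mq iq; apply/negP => q2.
have d : q ^+ 2 %| 'X^(n.+1) - 1 by rewrite -(monicpoly_F2 nza) dvdp_mull.
have qX : q %| 'X^n.
  have := @dvdp_deriv_exp _ q 1 _ d; rewrite expr1 derivB derivXn derivC subr0 /=.
  by rewrite mulrSr {2}nE mulnC mulrn2_F2 add0r.
have q1 : q %| 1.
  rewrite -[X in _ %| X](subKr 'X^(n.+1)); apply: dvdp_sub.
    by rewrite exprS dvdp_mull.
  by apply: dvdp_trans d; rewrite expr2 dvdp_mulr.
by move: q1; rewrite dvdp1 => /eqP s1; case: iq; rewrite s1.
Qed.

(** Here n is at least 3 and n + 1 = 2m with m >= 2. With h = (X^m - 1)/(X - 1), Frobenius gives f =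
    (X - 1) h^2, whose derivative in characteristic 2 is h^2: this is the common divisor. *)
Lemma monicpoly_F2_odd (a : 'rV[F]_n) : (2 <= n)%N -> ~~ (2 %| n)%N -> coefs_neq0 a ->
  exists w, [/\ w \is monic, (2 < size w)%N, w %| monicpoly a & w %| (monicpoly a)^`()].
Proof.
move=> n2 on nza; pose m := n.+1./2.
have nE : n.+1 = (m * 2)%N by rewrite /m; lia.
pose h : {poly F} := \sum_(i < m) 'X^i.
have hE : ('X - 1) * h = 'X^m - 1 by rewrite subrX1.
have m1 : ('X - 1 : {poly F}) \is monic by rewrite -polyC1 monicXsubC.
have m0 : (1 < m)%N by rewrite /m; lia.
have mh : h \is monic by rewrite -(monicMl _ m1) hE -polyC1 monicXnsubC // ltnW.
have sh : size h = m.
  have : size ('X^m - 1 : {poly F}) = m.+1 by rewrite -polyC1 size_XnsubC // ltnW.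
  rewrite -hE mulrC size_Mmonic ?monic_neq0 // -polyC1 size_XsubC addn2 /=.
  by case.
have fE : monicpoly a = ('X - 1) * h ^+ 2.
  have X1 : ('X - 1 : {poly F}) != 0 by rewrite monic_neq0.
  apply: (mulfI X1); rewrite monicpoly_F2 // nE exprM.
  rewrite mulrA -expr2 -exprMn hE sqrrB1 mulr2n addrr_F2 subr0.
  by congr (_ + _); apply/eqP; rewrite eq_sym -subr_eq0 opprK addrr_F2.
exists (h ^+ 2); split.
- exact: monic_exp.
- by rewrite expr2 size_Mmonic ?monic_neq0 // sh; lia.
- by rewrite fE dvdp_mull.
- rewrite fE derivM deriv_exp /= mulr2n addrr_F2 mulr0 addr0.
  by rewrite dvdp_mull.
Qed.

End Two.

Theorem theorem3p1 (R : realType) :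
  (forall (n : nat) (lambda : probability (padic_space 2 n) R),
      (2 <= n)%N -> is_haar lambda ->
      ((2 %| n)%N -> P_sqf lambda = 1) /\ (~~ (2 %| n)%N -> P_sqf lambda = 0))
  /\
  (exists C : R, forall (p n : nat) (lambda : probability (padic_space p n) R),
      prime p -> odd p -> (2 <= n)%N -> is_haar lambda ->
      `| P_sqf lambda - (1 - (3 * p%:R - 1) / (p%:R * (p%:R + 1) ^+ 2)) |
      <= C * (\sum_(0 <= d < n.+1) p%:R `^ (d%:R / 2) * delta R n p d
              + 1 / (p%:R `^ (n%:R / 2)))).
Proof.
split=> [n lambda n2 haar|].
  have pr2 : prime 2 by [].
  split=> n_parity.
    rewrite (P_sqf_count pr2 haar (Q := predT)); last first.
      by move=> ah y nza; split=> // _; apply: (disc_sqfree pr2); exact: monicpoly_F2_even.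
    under eq_bigr => a _ do rewrite (eq_card (B := {: 'rV['F_2]_n})) // card_mx mul1n
      card_Fp //.
    (* Over F_2 a single vector has all its entries nonzero, and all 2^n second digits are
       accepted. *)
    rewrite sumr_const (card_coefs_neq0 pr2) exp1n mulr1n natrX.
    have -> : (2%:R - 1 : R) = 1 by rewrite -[2%:R]natr1 addrK.
    by rewrite mulr1 divff // expf_neq0 // pnatr_eq0.
  rewrite (P_sqf_count pr2 haar (Q := pred0)); last first.
    move=> ah y nza; split=> // H; exfalso; apply: H.
    have [w [mw sw w1 w2]] := monicpoly_F2_odd n2 n_parity nza.
    exact: (disc_double pr2 _ mw sw).
  by rewrite big1 ?mul0r // => a _; rewrite eq_card0.
exists 5 => p n lambda pr op n2 haar.
rewrite (P_sqf_odd pr haar op n2).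
by apply: sqfree_simple_estimate => //; exact: ltnW.
Qed.
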